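(* Let $p$ be a prime greater than $5$. Then $$\sum_{k=1}^{p-1}\frac{21k-8}{k^3\binom{2k}{k}^3}+\frac{p-1}{p^3}\equiv\frac{H_{p-1}(1)}{p^2}(15p-6)+\frac{12}{5}\,p^2B_{p-5}\pmod{p^3}.$$
   Context: For an integer $n\ge 0$, $H_n(1)=\sum_{k=1}^n \frac{1}{k}$. $B_m\in\mathbb{Q}$ are the Bernoulli numbers defined by $\frac{t}{e^t-1}=\sum_{m\ge 0}B_m\frac{t^m}{m!}$. For rational numbers $x,y$ (whose denominators may be divisible by $p$), $x\equiv y\pmod{p^r}$ means that $x-y$ has $p$-adic valuation at least $r$. *)

(* Defs.v *)
From mathcomp Require Import all_boot all_order all_algebra.

Set Implicit Arguments.
Unset Strict Implicit.
Unset Printing Implicit Defensive.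

Import Order.TTheory GRing.Theory Num.Theory.
Local Open Scope ring_scope.

Definition harmonic_number (n : nat) : rat := \sum_(1 <= k < n.+1) k%:R^-1.

(* A formal power series over rat is represented by its coefficient sequence
   f : nat -> rat. *)
Definition fps_mul (f g : nat -> rat) (n : nat) : rat :=
  \sum_(i < n.+1) f i * g (n - i)%N.

(* The first n coefficients of 1 / f, found by solving f * g = 1 degree by
   degree; meaningful when f 0 != 0. *)
Fixpoint fps_inv_coefs (f : nat -> rat) (n : nat) : seq rat :=
  if n is m.+1 then
    let s := fps_inv_coefs f m in
    rcons s (((m == 0%N)%:R - \sum_(j < m) s`_j * f (m - j)%N) / f 0%N)
  else [::].

Definition fps_inv (f : nat -> rat) (n : nat) : rat :=
  (fps_inv_coefs f n.+1)`_n.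

(* e^t - 1 *)
Definition fps_expm1 (n : nat) : rat := if n is 0 then 0 else n`!%:R^-1.

(* t / (e^t - 1), computed as the inverse of the series (e^t - 1) / t, whose
   constant coefficient is 1. *)
Definition bernoulli_series : nat -> rat :=
  fps_inv (fun n => fps_expm1 n.+1).

Definition bernoulli (m : nat) : rat := m`!%:R * bernoulli_series m.

(* The value at x = 0, where the valuation is +oo, is junk. *)
Definition padic_val (p : nat) (x : rat) : int :=
  (logn p `|numq x|%N)%:Z - (logn p `|denq x|%N)%:Z.

Definition rat_eqmod (p r : nat) (x y : rat) : Prop :=
  x - y = 0 \/ r%:Z <= padic_val p (x - y).

Lemma size_fps_inv_coefs f n : size (fps_inv_coefs f n) = n.
Proof. by elim: n => //= n IHn; rewrite size_rcons IHn. Qed.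

Lemma nth_fps_inv_coefs f n i :
  (i < n)%N -> (fps_inv_coefs f n)`_i = fps_inv f i.
Proof.
elim: n => // n IHn; rewrite ltnS leq_eqVlt => /predU1P[-> //|lt_in].
by rewrite /= nth_rcons size_fps_inv_coefs lt_in IHn.
Qed.

Lemma fps_invE f n :
  fps_inv f n =
  ((n == 0%N)%:R - \sum_(j < n) fps_inv f j * f (n - j)%N) / f 0%N.
Proof.
rewrite {1}/fps_inv /= nth_rcons size_fps_inv_coefs ltnn eqxx.
by under eq_bigr => j _ do rewrite nth_fps_inv_coefs //.
Qed.

Lemma fps_mulVf f n :
  f 0%N != 0 -> fps_mul (fps_inv f) f n = (n == 0%N)%:R.
Proof.
move=> f0; rewrite /fps_mul big_ord_recr /= subnn (fps_invE f n) divfK //.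
by rewrite addrC subrK.
Qed.

(* (sum_m B_m t^m / m!) * (e^t - 1) = t *)
Lemma bernoulli_egf n :
  fps_mul (fun m => bernoulli m / m`!%:R) fps_expm1 n = (n == 1%N)%:R.
Proof.
rewrite /fps_mul big_ord_recr /= subnn mulr0 addr0.
case: n => [|n]; first by rewrite big_ord0.
rewrite eqSS -(@fps_mulVf (fun n => fps_expm1 n.+1)) ?invr1 ?oner_eq0 //.
apply: eq_bigr => i _; rewrite /bernoulli [_%:R * _]mulrC mulfK.
  by rewrite subSn // -ltnS.
by rewrite pnatr_eq0 -lt0n fact_gt0.
Qed.

(* Main.v *)
Require Import Defs.
From mathcomp Require Import all_boot all_order all_algebra.
From mathcomp Require Import ring lra zify.

(** Write n = p - 1, let H_m be the sum of k^-m over 0 < k < p, and put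
    F(n, k) = n!^4 k!^2 / ((2n)! (n + k + 1)!^2).
    This F has a Wilf-Zeilberger mate G, that is
    F(n + 1, k) - F(n, k) = G(n, k + 1) - G(n, k), so that (F, G) sums to the
    same value along any two lattice paths with common ends.  Along the diagonal
    staircase it gives the terms (21k - 8) / (k^3 binom(2k, k)^3); along the axis k = 0
    it gives 3 / (k^2 binom(2k, k)).  Going from (0, 0) to (n, n) along the axis
    and then horizontally gives [zeilberger_sum]: the sum of the theorem is
    three times the Apery sum of 1 / (k^2 binom(2k, k)), plus the sum of
    F(n, k) over k < n.

    Three times the Apery sum is H_1 / p modulo p^3 ([apery_sum_mod]), because it
    equals an alternating sum of k^-2 plus a sum of reciprocals of binomial
    products ([apery_sum]); for n = p - 1 the latter expand in powers of p into harmonic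
    sums.

    Up to a constant, F(p - 1, k) is b_k = binom(p + k, k)^-2.  Two telescoping
    relations between the sums of b_k, of b_k / k and of b_k / k^2 turn the sum
    of the b_k, which would be needed modulo p^6, into Z, the sum of b_k / k^2,
    which is needed modulo p^3 only ([sum_wz]).  Modulo p^3 one may replace b_k
    by (-1)^k binom(p - 1, k) / binom(p + k, k), a well-poised term whose sum
    against k^-2 has a closed form; this gives Z = 4 H_1 / p
    ([sum_invbin_mod]).  The same closed form, compared with that for the sum of
    (-1)^k binom(n, k) / k^2, evaluates the double harmonic sum that the Apery
    part needs ([harmonic_div_sqr]).

    What remains is binom(2p - 1, p - 1) modulo p^6, in terms of H_1 and H_3
    ([invbin_expansion]), and H_3 = -(6/5) p^2 B_(p-5) modulo p^3
    ([psum3_bernoulli]).  For the latter, reflecting k to p - k reduces H_3 to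
    p H_4, and multiplying the residues by 2 compares H_4 with the power sum of
    exponent p - 5 modulo p^2, which is p B_(p-5). *)

Set Implicit Arguments.
Unset Strict Implicit.
Unset Printing Implicit Defensive.

Import Order.TTheory GRing.Theory Num.Theory.
Local Open Scope ring_scope.

(** * Valuations of rational numbers *)

(** The valuation of x at p is at least r; for x = 0 this holds for every r.
    For r = 0 it says that x is p-integral. *)
Definition val_ge (p r : nat) (x : rat) : Prop :=
  exists (a : int) (d : nat), ~~ (p %| d)%N /\ x = p%:R ^+ r * a%:~R / d%:R.

Section Localization.
Variable p : nat.
Hypothesis p_prime : prime p.

Lemma prime_natr_neq0 : p%:R != 0 :> rat.
Proof. by rewrite pnatr_eq0 -lt0n prime_gt0. Qed.

Lemma ndvd_natr_neq0 d : ~~ (p %| d)%N -> d%:R != 0 :> rat.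
Proof. by apply: contraNneq => /eqP; rewrite pnatr_eq0 => /eqP->; rewrite dvdn0. Qed.

Lemma val_ge_int r (a : int) : val_ge p r (p%:R ^+ r * a%:~R).
Proof.
exists a, 1%N; split; last by rewrite divr1.
by rewrite Euclid_dvd1.
Qed.

Lemma val_ge0 r : val_ge p r 0.
Proof. by have := val_ge_int r 0; rewrite mulr0. Qed.

Lemma val_geD r x y : val_ge p r x -> val_ge p r y -> val_ge p r (x + y).
Proof.
move=> [a [d [pd ->]]] [b [e [pe ->]]].
exists (a * e%:Z + b * d%:Z), (d * e)%N; split.
  by rewrite Euclid_dvdM // negb_or pd.
have := ndvd_natr_neq0 pd; have := ndvd_natr_neq0 pe => e0 d0.
by rewrite natrM rmorphD !rmorphM /= !pmulrn; field; rewrite e0.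
Qed.

Lemma val_geN r x : val_ge p r x -> val_ge p r (- x).
Proof.
move=> [a [d [pd ->]]]; exists (- a), d; split=> //.
by rewrite rmorphN /= mulrN mulNr.
Qed.

Lemma val_geB r x y : val_ge p r x -> val_ge p r y -> val_ge p r (x - y).
Proof. by move=> hx hy; apply: val_geD => //; apply: val_geN. Qed.

Lemma val_geM r s x y : val_ge p r x -> val_ge p s y -> val_ge p (r + s) (x * y).
Proof.
move=> [a [d [pd ->]]] [b [e [pe ->]]].
exists (a * b), (d * e)%N; split.
  by rewrite Euclid_dvdM // negb_or pd.
have := ndvd_natr_neq0 pd; have := ndvd_natr_neq0 pe => e0 d0.
by rewrite natrM rmorphM /= exprD; field; rewrite e0.
Qed.

Lemma val_geMl r c x : val_ge p 0 c -> val_ge p r x -> val_ge p r (c * x).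
Proof. by move=> hc hx; rewrite -(add0n r); apply: val_geM. Qed.

Lemma val_geMr r c x : val_ge p 0 c -> val_ge p r x -> val_ge p r (x * c).
Proof. by rewrite mulrC; apply: val_geMl. Qed.

Lemma val_ge_nat n : val_ge p 0 n%:R.
Proof. by have := val_ge_int 0 n; rewrite mul1r. Qed.

Lemma val_geX x n : val_ge p 0 x -> val_ge p 0 (x ^+ n).
Proof.
move=> hx; elim: n => [|n IHn]; first exact: (val_ge_nat 1).
by rewrite exprS; apply: val_geMl.
Qed.

Lemma val_ge_invn d : ~~ (p %| d)%N -> val_ge p 0 (d%:R^-1).
Proof. by move=> pd; exists 1, d; split=> //; rewrite mul1r. Qed.

Lemma val_geP r x : val_ge p r x <-> exists2 y, val_ge p 0 y & x = p%:R ^+ r * y.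
Proof.
split=> [[a [d [pd ->]]]|[y [a [d [pd ->]]] ->]].
  exists (a%:~R / d%:R); first by exists a, d; rewrite mul1r.
  by rewrite mulrA.
by exists a, d; rewrite mul1r mulrA.
Qed.

(** Used to name the cofactors of p ^ r: a congruence then follows from a
    ring identity exhibiting its own cofactor. *)
Lemma val_ge_cofactor r x : val_ge p r x ->
  exists2 y, val_ge p 0 y & x = p%:R ^+ r * y.
Proof. exact: (proj1 (val_geP r x)). Qed.

Lemma val_ge_pX r x : val_ge p 0 x -> val_ge p r (p%:R ^+ r * x).
Proof. by move=> hx; apply/val_geP; exists x. Qed.

Lemma val_ge_mulp r x : val_ge p r.+1 (p%:R * x) <-> val_ge p r x.
Proof.
have p0 := prime_natr_neq0.
split; move=> /val_geP [y hy e]; apply/val_geP; exists y => //.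
  by apply: (mulfI p0); rewrite e exprS mulrA.
by rewrite e exprS mulrA.
Qed.

Lemma val_ge_le r s x : (s <= r)%N -> val_ge p r x -> val_ge p s x.
Proof.
move=> sr /val_geP [y hy ->]; apply/val_geP; exists (p%:R ^+ (r - s) * y).
  by apply: val_geMl => //; apply/val_geX/val_ge_nat.
by rewrite mulrA -exprD subnKC.
Qed.

Lemma val_ge_sum r (m n : nat) (f : nat -> rat) :
  (forall k, (m <= k < n)%N -> val_ge p r (f k)) ->
  val_ge p r (\sum_(m <= k < n) f k).
Proof.
move=> hf; rewrite big_nat_cond; apply: (big_ind (val_ge p r)).
- exact: val_ge0.
- exact: val_geD.
- by move=> i /andP[hi _]; apply: hf.
Qed.

Lemma val_ge_cancel r d x : ~~ (p %| d)%N -> val_ge p r (d%:R * x) -> val_ge p r x.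
Proof.
move=> pd h; rewrite -(mulKf (ndvd_natr_neq0 pd) x).
by apply: val_geMl => //; apply: val_ge_invn.
Qed.

Lemma val_ge_rat_eqmod r x y : val_ge p r (x - y) -> rat_eqmod p r x y.
Proof.
rewrite /rat_eqmod; set z := x - y => -[a [d [pd hz]]].
have [->|z0] := eqVneq z 0; [by left | right].
have a0 : a != 0 by apply: contraNneq z0 => a0; rewrite hz a0 mulr0 mul0r.
have d0 := ndvd_natr_neq0 pd.
have eZ : numq z * d%:Z = p%:Z ^+ r * a * denq z.
  apply: (@intr_inj rat); rewrite !rmorphM /= rmorphXn /=.
  rewrite numqE hz -[(d : int)%:~R]/(d%:R) -[(p : int)%:~R]/(p%:R).
  by field.
have eN : (`|numq z| * d = p ^ r * `|a| * `|denq z|)%N.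
  by have := congr1 absz eZ; rewrite !abszM abszX.
have nz0 : (0 < `|numq z|)%N by rewrite absz_gt0 numq_eq0.
have dz0 : (0 < `|denq z|)%N by rewrite absz_gt0 denq_neq0.
have aa0 : (0 < `|a|)%N by rewrite absz_gt0.
have dd0 : (0 < d)%N by case: (d) pd => //; rewrite dvdn0.
have := congr1 (logn p) eN.
rewrite !lognM ?muln_gt0 ?expn_gt0 ?(prime_gt0 p_prime) ?aa0 // pfactorK //.
rewrite (_ : logn p d = 0)%N ?addn0; last first.
  by apply/eqP; rewrite -leqn0 leqNgt logn_gt0 mem_primes p_prime dd0.
by rewrite /padic_val => ->; lia.
Qed.

End Localization.

(** * Power sums *)

Ltac natr_ge0 :=
  repeat match goal with n : nat |- _ =>
    lazymatch goal with
    | _ : is_true (0 <= (n%:R : rat)) |- _ => fail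
    | _ => let h := fresh in have h := ler0n rat n
    end end.

(** Closes the side conditions left by [field] when the denominators
    are positive combinations of natural numbers. *)
Ltac natr_neq0 :=
  repeat (apply/andP; split); try assumption;
  rewrite ?pnatr_eq0 ?expf_neq0 //;
  natr_ge0; apply: lt0r_neq0; lra.

Lemma sum_nat1S (f : nat -> rat) n :
  \sum_(1 <= k < n.+2) f k = \sum_(1 <= k < n.+1) f k + f n.+1.
Proof. by rewrite big_nat_recr. Qed.

Definition psum (m n : nat) : rat := \sum_(1 <= k < n.+1) k%:R^-1 ^+ m.

Lemma psumS m n : psum m n.+1 = psum m n + n.+1%:R^-1 ^+ m.
Proof. by rewrite /psum big_nat_recr. Qed.

Lemma psum0 m : psum m 0 = 0.
Proof. by rewrite /psum big_geq. Qed.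

(** * The Wilf-Zeilberger pair behind the series *)

Definition wz (n k : nat) : rat :=
  n`!%:R ^+ 4 * k`!%:R ^+ 2 / ((2 * n)`!%:R * (n + k).+1`!%:R ^+ 2).

(** The rational factor is the certificate of the pair. *)
Definition wz_mate (n k : nat) : rat :=
  wz n k * (3%:R * n%:R + 3%:R + 2%:R * k%:R) / (2%:R * (2%:R * n%:R + 1)).

Lemma factS_natr n : n.+1`!%:R = (n%:R + 1) * n`!%:R :> rat.
Proof. by rewrite factS natrM -natr1. Qed.

Lemma fact_natr_neq0 n : n`!%:R != 0 :> rat.
Proof. by rewrite pnatr_eq0 -lt0n fact_gt0. Qed.

Lemma fact_doubleS_natr n : (2 * n.+1)`!%:R =
  (2%:R * n%:R + 2) * (2%:R * n%:R + 1) * (2 * n)`!%:R :> rat.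
Proof.
rewrite mul2n doubleS -mul2n !factS_natr -!natr1 natrM; ring.
Qed.

Lemma wzSn n k : wz n.+1 k =
  wz n k * (n%:R + 1) ^+ 3 / (2%:R * (2%:R * n%:R + 1) * (n%:R + k%:R + 2) ^+ 2).
Proof.
rewrite /wz fact_doubleS_natr addSn !factS_natr.
have f1 := fact_natr_neq0 n; have f2 := fact_natr_neq0 k.
have f3 := fact_natr_neq0 (2 * n); have f4 := fact_natr_neq0 (n + k).
rewrite -!natr1 !natrD; field; natr_neq0.
Qed.

Lemma wzSk n k : wz n k.+1 =
  wz n k * (k%:R + 1) ^+ 2 / (n%:R + k%:R + 2) ^+ 2.
Proof.
rewrite /wz addnS !factS_natr.
have f1 := fact_natr_neq0 n; have f2 := fact_natr_neq0 k.
have f3 := fact_natr_neq0 (2 * n); have f4 := fact_natr_neq0 (n + k).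
rewrite -!natr1 !natrD; field; natr_neq0.
Qed.

Lemma wz_pair n k : wz n.+1 k - wz n k = wz_mate n k.+1 - wz_mate n k.
Proof. rewrite /wz_mate wzSn wzSk -natr1; field; natr_neq0. Qed.

Lemma bin2nn_natr n : 'C(2 * n, n)%:R = (2 * n)`!%:R / n`!%:R ^+ 2 :> rat.
Proof.
have nf := fact_natr_neq0 n; have := @bin_fact (2 * n) n.
rewrite mul2n -addnn addnK leq_addl => /(_ isT) <-.
by rewrite !natrM; field.
Qed.

Lemma wz_mate0 n : wz_mate n 0 = 3%:R / (n.+1%:R ^+ 2 * 'C(2 * n.+1, n.+1)%:R).
Proof.
rewrite /wz_mate /wz bin2nn_natr addn0 fact_doubleS_natr !factS_natr fact0.
have f1 := fact_natr_neq0 n; have f3 := fact_natr_neq0 (2 * n).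
rewrite -!natr1 ?natrM; field; natr_neq0.
Qed.

Lemma wz_diag n : wz n.+1 n + wz_mate n n =
  (21%:R * n.+1%:R - 8%:R) / (n.+1%:R ^+ 3 * 'C(2 * n.+1, n.+1)%:R ^+ 3).
Proof.
rewrite wzSn /wz_mate /wz bin2nn_natr addnn -mul2n fact_doubleS_natr !factS_natr.
have f1 := fact_natr_neq0 n; have f3 := fact_natr_neq0 (2 * n).
rewrite -!natr1 !natrM; field; natr_neq0.
Qed.

(** Going from n to n + 1 prolongs the diagonal by one step, and
    [wz_pair] moves the horizontal segment one level up; what the horizontal
    segment gains is a difference of two values of the mate, one on the diagonal
    and one on the axis. *)
Lemma zeilberger_sum n :
  \sum_(1 <= k < n.+1) (21%:R * k%:R - 8%:R) / (k%:R ^+ 3 * 'C(2 * k, k)%:R ^+ 3)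
  = \sum_(1 <= k < n.+1) 3%:R / (k%:R ^+ 2 * 'C(2 * k, k)%:R)
    + \sum_(0 <= k < n) wz n k.
Proof.
elim: n => [|n IHn]; first by rewrite !big_geq // addr0.
rewrite big_nat_recr //= IHn [in RHS]big_nat_recr //=.
rewrite [\sum_(0 <= k < n.+1) _]big_nat_recr //=.
have e : \sum_(0 <= k < n) wz n.+1 k - \sum_(0 <= k < n) wz n k
         = wz_mate n n - wz_mate n 0.
  rewrite -sumrB; under eq_bigr => k _ do rewrite wz_pair.
  by rewrite telescope_sumr.
by rewrite -wz_diag -wz_mate0 -(subrK (wz_mate n 0) (wz_mate n n)) -e; ring.
Qed.

(** * A finite form of Apery's series *)

(** This is (-1)^k / (k^2 binom(n, k) binom(n + k, k)) for 0 < k <= n, in a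
    form where both recurrences are immediate. *)
Definition alt_apery (n k : nat) : rat :=
  (-1) ^+ k * k.-1`!%:R ^+ 2 * (n - k)`!%:R / (n + k)`!%:R.

Lemma alt_aperySn n k : (k <= n)%N ->
  alt_apery n.+1 k = alt_apery n k * (n%:R + 1 - k%:R) / (n%:R + 1 + k%:R).
Proof.
move=> kn; rewrite /alt_apery subSn // addSn !factS_natr natrB // natrD.
have f1 := fact_natr_neq0 (n + k).
field; natr_neq0.
Qed.

Lemma alt_aperySk n k : (0 < k < n)%N ->
  alt_apery n k.+1 =
  - alt_apery n k * k%:R ^+ 2 / ((n%:R - k%:R) * (n%:R + k%:R + 1)).
Proof.
case: k => // k /= kn; rewrite /alt_apery -(subnSK kn) addnS /= !factS_natr.
rewrite [(-1) ^+ k.+2]exprS.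
have f1 := fact_natr_neq0 (n + k.+1).
have nk : n%:R - k.+1%:R != 0 :> rat by rewrite subr_eq0 eqr_nat gtn_eqF.
rewrite natrB // -natr1 natrD -!natr1 in nk *.
field; rewrite nk; natr_neq0.
Qed.

(** The summand is 2 (n + 1) / (n + 1 + k) times alt_apery n k, and
    telescopes with antidifference
    -2 (n + 1 - k) / (n + 1) alt_apery n k. *)
Lemma sum_alt_apery_step n :
  \sum_(1 <= k < n.+1) (alt_apery n.+1 k + alt_apery n k) =
  (-1) ^+ n * 2%:R / (n%:R + 1) * n`!%:R ^+ 2 / (2 * n).+1`!%:R - 2%:R / n.+1%:R ^+ 2.
Proof.
(* the antidifference, with the factor n + 1 - k absorbed by the factorial *)
pose U k : rat := - (2%:R / n.+1%:R) *
  ((-1) ^+ k * k.-1`!%:R ^+ 2 * (n.+1 - k)`!%:R / (n + k)`!%:R).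
have -> : \sum_(1 <= k < n.+1) (alt_apery n.+1 k + alt_apery n k) =
          \sum_(1 <= k < n.+1) (U k.+1 - U k).
  apply: eq_big_nat => k /andP[k0 kn]; rewrite alt_aperySn // /U /alt_apery /=.
  rewrite subSS subSn // addnS !factS_natr [(-1) ^+ k.+1]exprS.
  case: k k0 kn => // k _ kn /=; rewrite factS_natr -!natr1.
  have f1 := fact_natr_neq0 (n + k.+1); have f2 := fact_natr_neq0 (n - k.+1).
  rewrite natrD natrB // -!natr1; field; natr_neq0.
rewrite telescope_sumr // /U /= subnn fact0 subn1 /= addn1 addnS addnn -mul2n.
rewrite !factS_natr expr1 [(-1) ^+ n.+1]exprS -!natr1.
have f1 := fact_natr_neq0 n; have f2 := fact_natr_neq0 (2 * n).
rewrite natrM; field; natr_neq0.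
Qed.

(** The finite form of Apery's series for zeta(2).  Passing from n to
    n + 1, the telescoped sum of [sum_alt_apery_step] and the new term k = n + 1 on
    the right add up to the new central binomial term. *)
Lemma apery_sum n :
  \sum_(1 <= k < n.+1) 3%:R / (k%:R ^+ 2 * 'C(2 * k, k)%:R)
  = 2%:R * \sum_(1 <= k < n.+1) (-1) ^+ k.-1 * k%:R^-1 ^+ 2
    - (-1) ^+ n * \sum_(1 <= k < n.+1) alt_apery n k.
Proof.
elim: n => [|n IHn]; first by rewrite !big_geq // !mulr0 subrr.
rewrite big_nat_recr //= IHn [\sum_(1 <= k < n.+2) (-1) ^+ k.-1 * _]big_nat_recr //=.
rewrite [\sum_(1 <= k < n.+2) alt_apery _ _]big_nat_recr //=.
have := sum_alt_apery_step n; rewrite big_split /= => /(canRL (addrK _)) ->.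
rewrite /alt_apery subnn fact0 bin2nn_natr addnn -mul2n fact_doubleS_natr !factS_natr.
have f1 := fact_natr_neq0 n; have f2 := fact_natr_neq0 (2 * n).
have := sqrr_sign rat n; rewrite ![(-1) ^+ n.+1]exprS -!natr1 /= ?natrM.
set S := \sum_(_ <= _ < _) _; set A := \sum_(_ <= _ < _) _.
move: ((-1) ^+ n) => s s2.
apply/eqP; rewrite -subr_eq0; apply/eqP.
(* both sides differ by a multiple of 1 - s ^+ 2, where s is the sign *)
transitivity ((1 - s ^+ 2) * (3%:R * n`!%:R ^+ 2
    / ((2%:R * n%:R + 2) * (2%:R * n%:R + 1) * (2 * n)`!%:R))).
  by field; natr_neq0.
by rewrite s2 subrr mul0r.
Qed.

(** * Quotients of binomial coefficients *)

(** 1 / binom(x + k, k). *)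
Definition invbin (x : rat) (k : nat) : rat :=
  \prod_(1 <= j < k.+1) (j%:R / (j%:R + x)).

Lemma invbinS x k : invbin x k.+1 = invbin x k * (k.+1%:R / (k.+1%:R + x)).
Proof. by rewrite /invbin big_nat_recr. Qed.

Lemma invbin0 x : invbin x 0 = 1.
Proof. by rewrite /invbin big_geq. Qed.

(** With b_k = invbin x k ^+ 2 one has (k + x)^2 b_k = k^2 b_(k-1);
    this is the sum of that relation divided by k. *)
Lemma sum_invbin_sqr x n : 0 <= x ->
  (1 - 2%:R * x) * \sum_(1 <= k < n.+1) invbin x k ^+ 2 =
  x ^+ 2 * \sum_(1 <= k < n.+1) invbin x k ^+ 2 / k%:R
  + n.+1%:R * invbin x n ^+ 2 - 1.
Proof.
move=> x0; elim: n => [|n IHn]; first by rewrite !big_geq // invbin0; ring.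
rewrite !sum_nat1S !mulrDr IHn invbinS -!natr1.
move: (\sum_(_ <= _ < _) _ / _) => s; field; natr_neq0.
Qed.

(** The sum of the relation (k + x)^2 b_k = k^2 b_(k-1) divided
    by k^2. *)
Lemma sum_invbin_sqr_div x n : 0 <= x ->
  2%:R * x * \sum_(1 <= k < n.+1) invbin x k ^+ 2 / k%:R
  + x ^+ 2 * \sum_(1 <= k < n.+1) invbin x k ^+ 2 / k%:R ^+ 2
  = 1 - invbin x n ^+ 2.
Proof.
move=> x0; elim: n => [|n IHn]; first by rewrite !big_geq // invbin0; ring.
rewrite !sum_nat1S !mulrDr addrACA IHn invbinS -!natr1.
field; natr_neq0.
Qed.

(** (-1)^k binom(2x, x + k) / binom(2x, x). *)
Definition cbin (x : rat) (k : nat) : rat :=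
  \prod_(1 <= j < k.+1) ((j.-1%:R - x) / (j%:R + x)).

Lemma cbinS x k : cbin x k.+1 = cbin x k * ((k%:R - x) / (k.+1%:R + x)).
Proof. by rewrite /cbin big_nat_recr. Qed.

Lemma cbin0 x : cbin x 0 = 1.
Proof. by rewrite /cbin big_geq. Qed.

Lemma cbin_small n k : (n < k)%N -> cbin n%:R k = 0.
Proof.
elim: k => // k IHk; rewrite ltnS leq_eqVlt cbinS => /predU1P[->|/IHk->].
  by rewrite subrr mul0r mulr0.
by rewrite mul0r.
Qed.

Lemma cbin_shift x k : 0 <= x ->
  (x + 1) ^+ 2 * cbin x k = ((x + 1) ^+ 2 - k%:R ^+ 2) * cbin (x + 1) k.
Proof.
move=> x0; elim: k => [|k IHk]; first by rewrite !cbin0; ring.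
rewrite !cbinS mulrA IHk -!natr1; field; natr_neq0.
Qed.

(** For x = n the boundary term vanishes and the sum is -1/2, by the symmetry
    of a row of binomial coefficients with alternating sum 0. *)
Lemma sum_cbin x n : 0 < x ->
  \sum_(1 <= k < n.+1) cbin x k = (x - n%:R) / (2%:R * x) * cbin x n - 2%:R^-1.
Proof.
move=> x0; elim: n => [|n IHn]; first by rewrite big_geq // cbin0; field; lra.
rewrite sum_nat1S IHn cbinS -natr1; field; natr_neq0.
Qed.

Lemma sum_mul_cbin x n : 1 <= x ->
  \sum_(1 <= k < n.+1) k%:R * cbin x k =
  (2%:R * n%:R + 1) * (x - n%:R) / (2%:R * (2%:R * x - 1)) * cbin x n
  - x / (2%:R * (2%:R * x - 1)).
Proof.
move=> x1; elim: n => [|n IHn].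
  by rewrite big_geq // cbin0; field; natr_neq0.
rewrite sum_nat1S IHn cbinS -natr1; field; natr_neq0.
Qed.

(** The difference of cbin n.+1 k and cbin n k is k^2 / (n + 1)^2 times
    cbin n.+1 k.  Divided by k or k^2 it has a sum that telescopes in k; hence the
    sums of cbin n k / k and cbin n k / k^2 follow by induction on n. *)
Lemma cbin_shift_div n k : (0 < k)%N ->
  cbin n.+1%:R k / k%:R ^+ 2 =
  cbin n%:R k / k%:R ^+ 2 + cbin n.+1%:R k / n.+1%:R ^+ 2.
Proof.
case: k => // k _; have := cbin_shift k.+1 (ler0n rat n).
rewrite -!natr1 => /(canRL (mulKf _)) ->; last by natr_neq0.
field; natr_neq0.
Qed.

Lemma sum_cbin_sqr n :
  \sum_(1 <= k < n.+1) cbin n%:R k / k%:R ^+ 2 = - psum 2 n / 2%:R.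
Proof.
elim: n => [|n IHn]; first by rewrite big_geq // psum0 oppr0 mul0r.
have -> : \sum_(1 <= k < n.+2) cbin n.+1%:R k / k%:R ^+ 2
  = \sum_(1 <= k < n.+2) (cbin n%:R k / k%:R ^+ 2 + cbin n.+1%:R k / n.+1%:R ^+ 2).
  by apply: eq_big_nat => k /andP[k0 _]; apply: cbin_shift_div.
rewrite big_split /= -mulr_suml sum_cbin // subrr.
rewrite sum_nat1S IHn cbin_small // psumS -natr1; field; natr_neq0.
Qed.

Lemma sum_cbin_div n :
  \sum_(1 <= k < n.+1) cbin n%:R k / k%:R = psum 1 n - psum 1 (2 * n).
Proof.
elim: n => [|n IHn]; first by rewrite big_geq // psum0 subrr.
have -> : \sum_(1 <= k < n.+2) cbin n.+1%:R k / k%:R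
  = \sum_(1 <= k < n.+2) (cbin n%:R k / k%:R + (k%:R * cbin n.+1%:R k) / n.+1%:R ^+ 2).
  apply: eq_big_nat => k /andP[k0 _].
  have kn0 : k%:R != 0 :> rat by rewrite pnatr_eq0 -lt0n.
  transitivity (k%:R * (cbin n.+1%:R k / k%:R ^+ 2)); first by field.
  by rewrite cbin_shift_div //; field; rewrite kn0; natr_neq0.
rewrite big_split /= -mulr_suml sum_mul_cbin ?ler1n // subrr.
rewrite sum_nat1S IHn cbin_small // [(2 * n.+1)%N]mul2n.
rewrite doubleS !psumS -mul2n -!natr1 ?natrM.
field; natr_neq0.
Qed.

(** (-1)^k binom(x, k). *)
Definition sbin (x : rat) (k : nat) : rat :=
  \prod_(1 <= j < k.+1) ((j.-1%:R - x) / j%:R).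

Lemma sbinS x k : sbin x k.+1 = sbin x k * ((k%:R - x) / k.+1%:R).
Proof. by rewrite /sbin big_nat_recr. Qed.

Lemma sbin0 x : sbin x 0 = 1.
Proof. by rewrite /sbin big_geq. Qed.

Lemma sbin_small n k : (n < k)%N -> sbin n%:R k = 0.
Proof.
elim: k => // k IHk; rewrite ltnS leq_eqVlt sbinS => /predU1P[->|/IHk->].
  by rewrite subrr mul0r mulr0.
by rewrite mul0r.
Qed.

Lemma sbin_shift x k : 0 <= x ->
  (x + 1) * sbin x k = (x + 1 - k%:R) * sbin (x + 1) k.
Proof.
move=> x0; elim: k => [|k IHk]; first by rewrite !sbin0; ring.
rewrite !sbinS mulrA IHk -!natr1; field; natr_neq0.
Qed.

Lemma sum_sbin x n : 0 < x ->
  \sum_(1 <= k < n.+1) sbin x k = (x - n%:R) / x * sbin x n - 1.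
Proof.
move=> x0; elim: n => [|n IHn]; first by rewrite big_geq // sbin0; field; lra.
rewrite sum_nat1S IHn sbinS -natr1; field; natr_neq0.
Qed.

Lemma sbin_shift_div n k : (0 < k)%N ->
  sbin n.+1%:R k / k%:R = sbin n%:R k / k%:R + sbin n.+1%:R k / n.+1%:R.
Proof.
case: k => // k _; have := sbin_shift k.+1 (ler0n rat n).
rewrite -!natr1 => /(canRL (mulKf _)) ->; last by natr_neq0.
field; natr_neq0.
Qed.

Lemma sum_sbin_div n :
  \sum_(1 <= k < n.+1) sbin n%:R k / k%:R = - psum 1 n.
Proof.
elim: n => [|n IHn]; first by rewrite big_geq // psum0 oppr0.
have -> : \sum_(1 <= k < n.+2) sbin n.+1%:R k / k%:R
  = \sum_(1 <= k < n.+2) (sbin n%:R k / k%:R + sbin n.+1%:R k / n.+1%:R).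
  by apply: eq_big_nat => k /andP[k0 _]; apply: sbin_shift_div.
rewrite big_split /= -mulr_suml sum_sbin // subrr.
rewrite sum_nat1S IHn sbin_small // psumS -natr1; field; natr_neq0.
Qed.

(** The increment from n - 1 to n is the sum of sbin n k / k, known from
    [sum_sbin_div], divided by n. *)
Lemma sum_sbin_sqr n :
  \sum_(1 <= k < n.+1) sbin n%:R k / k%:R ^+ 2
  = - (psum 1 n ^+ 2 + psum 2 n) / 2%:R.
Proof.
elim: n => [|n IHn]; first by rewrite big_geq // !psum0; ring.
have -> : \sum_(1 <= k < n.+2) sbin n.+1%:R k / k%:R ^+ 2
  = \sum_(1 <= k < n.+2)
      (sbin n%:R k / k%:R ^+ 2 + sbin n.+1%:R k / k%:R / n.+1%:R).
  apply: eq_big_nat => k /andP[k0 _].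
  have kn0 : k%:R != 0 :> rat by rewrite pnatr_eq0 -lt0n.
  transitivity (sbin n.+1%:R k / k%:R / k%:R); first by field.
  by rewrite {1}sbin_shift_div //; field; rewrite kn0; natr_neq0.
rewrite big_split /= -mulr_suml sum_sbin_div.
rewrite sum_nat1S IHn sbin_small // !psumS -natr1; field; natr_neq0.
Qed.

(** (-1)^k binom(x - 1, k) / binom(x + k, k). *)
Definition wpbin (x : rat) (k : nat) : rat :=
  \prod_(1 <= j < k.+1) ((j%:R - x) / (j%:R + x)).

Lemma wpbinS x k : wpbin x k.+1 = wpbin x k * ((k.+1%:R - x) / (k.+1%:R + x)).
Proof. by rewrite /wpbin big_nat_recr. Qed.

Lemma wpbin0 x : wpbin x 0 = 1.
Proof. by rewrite /wpbin big_geq. Qed.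

Lemma wpbin_cbin x k : 0 < x -> wpbin x k = (1 - k%:R / x) * cbin x k.
Proof.
move=> x0; elim: k => [|k IHk]; first by rewrite wpbin0 cbin0; ring.
rewrite wpbinS cbinS IHk -!natr1; field; natr_neq0.
Qed.

(** A combination of the closed forms for cbin n k / k^2 and
    cbin n k / k, by [wpbin_cbin]. *)
Lemma sum_wpbin_sqr n :
  \sum_(1 <= k < n.+1) wpbin n.+1%:R k / k%:R ^+ 2 =
  - psum 2 n.+1 / 2%:R + (psum 1 (2 * n.+1) - psum 1 n.+1) / n.+1%:R.
Proof.
have := sum_cbin_sqr n.+1; have := sum_cbin_div n.+1.
rewrite !sum_nat1S => /(canRL (addrK _)) e1 /(canRL (addrK _)) e2.
transitivity (\sum_(1 <= k < n.+1) cbin n.+1%:R k / k%:R ^+ 2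
              - n.+1%:R^-1 * \sum_(1 <= k < n.+1) cbin n.+1%:R k / k%:R).
  rewrite mulr_sumr -sumrB; apply: eq_big_nat => k /andP[k0 kn].
  have kn0 : k%:R != 0 :> rat by rewrite pnatr_eq0 -lt0n.
  by rewrite wpbin_cbin // -natr1; field; rewrite kn0; natr_neq0.
rewrite e1 e2; move: (cbin _ _) (psum 1 n.+1) (psum 2 n.+1) (psum 1 (2 * n.+1)).
by move=> a b c d; rewrite -natr1; field; natr_neq0.
Qed.

Definition sqbin (x : rat) (k : nat) : rat :=
  \prod_(1 <= j < k.+1) (j%:R ^+ 2 / (j%:R ^+ 2 - x ^+ 2)).

Lemma sqbinS x k : sqbin x k.+1 =
  sqbin x k * (k.+1%:R ^+ 2 / (k.+1%:R ^+ 2 - x ^+ 2)).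
Proof. by rewrite /sqbin big_nat_recr. Qed.

Lemma sqbin0 x : sqbin x 0 = 1.
Proof. by rewrite /sqbin big_geq. Qed.

(** The squares that occur in the horizontal part differ from the
    well-poised quotient by a factor that is 1 modulo p^2 when x = p. *)
Lemma invbin_sqr n k : (k < n)%N ->
  invbin n%:R k ^+ 2 = wpbin n%:R k * sqbin n%:R k.
Proof.
elim: k => [|k IHk] kn; first by rewrite invbin0 wpbin0 sqbin0; ring.
rewrite invbinS exprMn IHk 1?ltnW // wpbinS sqbinS.
have kn0 : n%:R - k.+1%:R != 0 :> rat by rewrite subr_eq0 eqr_nat gtn_eqF.
have -> : k.+1%:R ^+ 2 - n%:R ^+ 2
  = - (n%:R - k.+1%:R) * (k.+1%:R + n%:R) :> rat by ring.
have -> : k.+1%:R - n%:R = - (n%:R - k.+1%:R) :> rat by ring.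
by field; rewrite nat1r kn0 andbT; natr_neq0.
Qed.

(** For n = p - 1 the product binom(n, k) binom(n + k, k) is a
    simple factor times the product of (p^2 - j^2) / j^2 over j <= k. *)
Lemma alt_apery_sqbin p k : (1 < p)%N -> (0 < k < p)%N ->
  p%:R * alt_apery p.-1 k = (p%:R / k%:R ^+ 2 + k%:R^-1) * sqbin p%:R k.
Proof.
case: p => // -[] // m _; rewrite [_.-1]/=.
case: k => // k /=; elim: k => [|k IHk] kn.
  rewrite sqbinS sqbin0 /alt_apery subn1 addn1 !factS_natr fact0 /=.
  have -> : 1 ^+ 2 - m.+2%:R ^+ 2 = - (m%:R + 1) * (m%:R + 3) :> rat.
    by rewrite -!natr1; ring.
  have f := fact_natr_neq0 m; rewrite -!natr1; field; natr_neq0.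
have kn0 : m.+2%:R - k.+2%:R != 0 :> rat by rewrite subr_eq0 eqr_nat gtn_eqF.
rewrite alt_aperySk // -[- _ * _ / _]mulrA mulNr mulrN mulrA IHk 1?ltnW //.
rewrite (sqbinS _ k.+1).
have -> : k.+2%:R ^+ 2 - m.+2%:R ^+ 2
  = - (m.+2%:R - k.+2%:R) * (k.+2%:R + m.+2%:R) :> rat by ring.
rewrite -!natr1 in kn0 *; field; rewrite kn0; natr_neq0.
Qed.

(** * Expansions of binomial quotients in powers of p *)

Lemma ndvd_small p d : (0 < d < p)%N -> ~~ (p %| d)%N.
Proof. by case/andP=> d0 dp; rewrite gtnNdvd. Qed.

Lemma val_ge1 p (p_prime : prime p) : val_ge p 0 1.
Proof. exact: (val_ge_nat p_prime 1). Qed.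

(** Directed by the head symbol of the expression: were unification to
    choose among the closure lemmas, it would unfold numerals into sums. *)
Ltac p_integral :=
  first
    [ assumption
    | lazymatch goal with
      | |- val_ge _ 0 1 => apply: val_ge1; assumption
      | |- val_ge _ 0 (GRing.natmul 1 _) => apply: val_ge_nat; assumption
      | |- val_ge _ 0 (- _) => apply: val_geN; p_integral
      | |- val_ge _ 0 (_ + _) => apply: val_geD; p_integral
      | |- val_ge _ 0 (_ ^+ _) => apply: val_geX; p_integral
      | |- val_ge _ 0 (_ * _) => apply: val_geMl; p_integral
      | |- val_ge _ 0 (_^-1) => apply: val_ge_invn; apply: ndvd_small; lia
      end ].

Section Expansions.
Variable p : nat.
Hypothesis p_prime : prime p.
Local Notation P := (p%:R : rat).

Lemma val_ge_psum m k : (k < p)%N -> val_ge p 0 (psum m k).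
Proof.
move=> kp; apply: val_ge_sum => // j /andP[j0 jk].
by p_integral.
Qed.

Lemma val_ge_inv_add k : (0 < k < p)%N -> val_ge p 0 (k%:R + P)^-1.
Proof.
by move=> kp; rewrite -natrD; apply: val_ge_invn => //; rewrite dvdn_addl // ndvd_small.
Qed.

Lemma natr_subp_neq0 k : (0 < k < p)%N -> P - k%:R != 0.
Proof. by case/andP=> _ kp; rewrite subr_eq0 eqr_nat gtn_eqF. Qed.

Lemma val_ge_inv_sub k : (0 < k < p)%N -> val_ge p 0 (P - k%:R)^-1.
Proof.
move=> kp; rewrite -natrB; last by case/andP: kp => _ /ltnW.
by apply: val_ge_invn => //; apply: ndvd_small; lia.
Qed.

(** The j-th factor is 1 / (1 - y^2) with y = p / j. *)
Lemma sqbin_expansion k : (k < p)%N ->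
  val_ge p 4 (sqbin P k - (1 + P ^+ 2 * psum 2 k)).
Proof.
elim: k => [|k IHk] kp.
  by rewrite sqbin0 psum0 mulr0 addr0 subrr; apply: val_ge0.
have kp' : (0 < k.+1 < p)%N by lia.
have [y hy /(canRL (subrK _)) e] := val_ge_cofactor (IHk (ltnW kp)).
have a1 := val_ge_inv_add kp'; have a2 := val_ge_inv_sub kp'.
have b1 : k.+1%:R + P != 0 by natr_neq0.
have b2 := natr_subp_neq0 kp'.
have hs : val_ge p 0 (psum 2 k) by apply: val_ge_psum; lia.
have hu : val_ge p 0 (k.+1%:R^-1) by p_integral.
rewrite sqbinS psumS e.
have -> : k.+1%:R ^+ 2 - P ^+ 2 = - (P - k.+1%:R) * (k.+1%:R + P) by ring.
have k1 : k.+1%:R != 0 :> rat by rewrite pnatr_eq0.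
move: (psum 2 k) (k.+1%:R) => h K in hs hu a1 a2 b1 b2 k1 *.
pose v := - (P - K)^-1 * (K + P)^-1.
have -> : (P ^+ 4 * y + (1 + P ^+ 2 * h)) * (K ^+ 2 / (- (P - K) * (K + P)))
          - (1 + P ^+ 2 * (h + K^-1 ^+ 2))
  = P ^+ 4 * (y * (1 + P ^+ 2 * K^-1 ^+ 2 + P ^+ 4 * K^-1 ^+ 2 * v)
              + h * K^-1 ^+ 2 + K^-1 ^+ 2 * v * (1 + P ^+ 2 * h)).
  by rewrite /v; field; rewrite b1 b2 k1.
by apply: val_ge_pX => //; rewrite /v; p_integral.
Qed.

(** The j-th factor is (1 - y) / (1 + y) = exp(-2y + O(y^3)) with y = p / j, so
    modulo p^3 the product is the exponential of -2 p psum 1 k. *)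
Lemma wpbin_expansion k : (k < p)%N ->
  val_ge p 3 (wpbin P k - (1 - 2%:R * P * psum 1 k + 2%:R * P ^+ 2 * psum 1 k ^+ 2)).
Proof.
elim: k => [|k IHk] kp.
  rewrite wpbin0 psum0 (_ : _ - _ = 0); first exact: val_ge0.
  by ring.
have kp' : (0 < k.+1 < p)%N by lia.
have [y hy /(canRL (subrK _)) e] := val_ge_cofactor (IHk (ltnW kp)).
have a1 := val_ge_inv_add kp'.
have b1 : k.+1%:R + P != 0 by natr_neq0.
have hs : val_ge p 0 (psum 1 k) by apply: val_ge_psum; lia.
have hu : val_ge p 0 (k.+1%:R^-1) by p_integral.
rewrite wpbinS psumS e expr1.
have k1 : k.+1%:R != 0 :> rat by rewrite pnatr_eq0.
move: (psum 1 k) (k.+1%:R) => h K in hs hu a1 b1 k1 *.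
have -> : (P ^+ 3 * y + (1 - 2%:R * P * h + 2%:R * P ^+ 2 * h ^+ 2))
            * ((K - P) / (K + P))
          - (1 - 2%:R * P * (h + K^-1) + 2%:R * P ^+ 2 * (h + K^-1) ^+ 2)
  = P ^+ 3 * (y * (1 - 2%:R * P * (K + P)^-1)
       - 4%:R * h * K^-1 ^+ 2 - 4%:R * h ^+ 2 * K^-1 + 4%:R * P * h ^+ 2 * K^-1 ^+ 2
       - 2%:R * K^-1 ^+ 2 * (K + P)^-1 * (1 - 2%:R * P * h + 2%:R * P ^+ 2 * h ^+ 2)).
  by field; rewrite b1 k1.
by apply: val_ge_pX => //; p_integral.
Qed.

Hypothesis p_gt5 : (5 < p)%N.

(** For x = p - 1 the j-th factor is 1 - p / j, so the coefficients are elementary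
    symmetric functions of the reciprocals. *)
Lemma sbin_expansion k : (k < p)%N ->
  val_ge p 3 (sbin p.-1%:R k
           - (1 - P * psum 1 k + P ^+ 2 * (psum 1 k ^+ 2 - psum 2 k) / 2%:R)).
Proof.
elim: k => [|k IHk] kp.
  rewrite sbin0 !psum0 (_ : _ - _ = 0); first exact: val_ge0.
  by ring.
have kp' : (0 < k.+1 < p)%N by lia.
have [y hy /(canRL (subrK _)) e] := val_ge_cofactor (IHk (ltnW kp)).
have hs : val_ge p 0 (psum 1 k) by apply: val_ge_psum; lia.
have hs2 : val_ge p 0 (psum 2 k) by apply: val_ge_psum; lia.
have hu : val_ge p 0 (k.+1%:R^-1) by p_integral.
rewrite sbinS !psumS e expr1.
have -> : k%:R - p.-1%:R = k.+1%:R - P.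
  by rewrite -{2}(prednK (prime_gt0 p_prime)) -!natr1; ring.
have k1 : k.+1%:R != 0 :> rat by rewrite pnatr_eq0.
move: (psum 1 k) (psum 2 k) (k.+1%:R) => h h2 K in hs hs2 hu k1 *.
have -> : (P ^+ 3 * y + (1 - P * h + P ^+ 2 * (h ^+ 2 - h2) / 2%:R))
            * ((K - P) / K)
          - (1 - P * (h + K^-1) + P ^+ 2 * ((h + K^-1) ^+ 2 - (h2 + K^-1 ^+ 2)) / 2%:R)
  = P ^+ 3 * (y * (1 - P * K^-1) - K^-1 * (h ^+ 2 - h2) / 2%:R).
  by field.
by apply: val_ge_pX => //; p_integral.
Qed.

End Expansions.

(** * Reflection and doubling of power sums *)

Lemma sum_reflect (f : nat -> rat) n :
  \sum_(1 <= k < n) f k = \sum_(1 <= k < n) f (n - k)%N.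
Proof.
rewrite big_nat_rev /=; apply: eq_big_nat => k /andP[k0 kn].
by congr f; lia.
Qed.

Lemma sum_fold (f : nat -> rat) m :
  \sum_(1 <= k < (2 * m).+1) f k =
  \sum_(1 <= i < m.+1) (f i + f ((2 * m).+1 - i)%N).
Proof.
rewrite big_split /= (@big_cat_nat _ _ _ m.+1) //=; last by lia.
congr (_ + _); rewrite big_nat_rev /= -{1}(add1n m) big_addn.
have -> : ((2 * m).+1 - m = m.+1)%N by lia.
by apply: eq_big_nat => k /andP[k0 km]; congr f; lia.
Qed.

Lemma sum_even_odd (f : nat -> rat) m :
  \sum_(1 <= k < (2 * m).+1) f k = \sum_(1 <= i < m.+1) (f (2 * i)%N + f (2 * i).-1).
Proof.
elim: m => [|m IHm]; first by rewrite !big_geq.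
rewrite (_ : (2 * m.+1).+1 = (2 * m).+3); last by lia.
rewrite !sum_nat1S IHm (_ : (2 * m.+1)%N = (2 * m).+2); last by lia.
by rewrite /= -!addrA [f _.+2 + _]addrC.
Qed.

Lemma sum_even_odd_reflect (f : nat -> rat) m :
  \sum_(1 <= k < (2 * m).+1) f k =
  \sum_(1 <= i < m.+1) (f (2 * i)%N + f ((2 * m).+1 - 2 * i)%N).
Proof.
rewrite sum_even_odd !big_split /=; congr (_ + _).
rewrite big_nat_rev /=; apply: eq_big_nat => k /andP[k0 km].
by congr f; lia.
Qed.

(** Doubling permutes the nonzero residues modulo 2m + 1: the doubles
    up to 2m are the even residues, the others are 2m + 1 plus the odd ones. *)
Lemma sum_double (f : nat -> rat) m :
  \sum_(1 <= k < (2 * m).+1) f (2 * k)%N - \sum_(1 <= k < (2 * m).+1) f k =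
  \sum_(1 <= i < m.+1) (f ((2 * m).+1 + (2 * i).-1)%N - f (2 * i).-1).
Proof.
have -> : \sum_(1 <= k < (2 * m).+1) f (2 * k)%N =
  \sum_(1 <= i < m.+1) f (2 * i)%N
  + \sum_(1 <= i < m.+1) f ((2 * m).+1 + (2 * i).-1)%N.
  rewrite (@big_cat_nat _ _ _ m.+1) //=; last by lia.
  congr (_ + _); rewrite -{1}(add1n m) big_addn.
  rewrite (_ : ((2 * m).+1 - m = m.+1)%N); last by lia.
  by apply: eq_big_nat => k /andP[k0 km]; congr f; lia.
by rewrite sum_even_odd big_split /= sumrB; ring.
Qed.

(** The pairs (i, j) with i <= j and those with j <= i cover the square,
    and the diagonal twice. *)
Lemma stuffle (a b n : nat) :
  \sum_(1 <= k < n.+1) (psum a k * k%:R^-1 ^+ b + psum b k * k%:R^-1 ^+ a)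
  = psum a n * psum b n + psum (a + b) n.
Proof.
elim: n => [|n IHn]; first by rewrite big_geq // !psum0; ring.
by rewrite sum_nat1S IHn !psumS exprD; ring.
Qed.

Section PowerSums.
Variable p : nat.
Hypothesis p_prime : prime p.
Hypothesis p_gt5 : (5 < p)%N.
Local Notation P := (p%:R : rat).
Local Notation H m := (psum m p.-1).

Lemma psum_predp m : H m = \sum_(1 <= k < p) k%:R^-1 ^+ m.
Proof. by rewrite /psum prednK // prime_gt0. Qed.

(** The geometric expansion of 1 / (p - k) in powers of p / k. *)
Lemma reflect_inv k : (0 < k < p)%N ->
  val_ge p 4 (k%:R^-1 + (p - k)%N%:R^-1
           + P * k%:R^-1 ^+ 2 + P ^+ 2 * k%:R^-1 ^+ 3 + P ^+ 3 * k%:R^-1 ^+ 4).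
Proof.
move=> kp; have a := val_ge_inv_sub p_prime kp; have b := natr_subp_neq0 kp.
have k0 : k%:R != 0 :> rat by rewrite pnatr_eq0; lia.
have hu : val_ge p 0 k%:R^-1 by p_integral.
rewrite natrB; last by lia.
rewrite (_ : _ + _ = P ^+ 4 * (k%:R^-1 ^+ 4 * (P - k%:R)^-1)).
  by apply: val_ge_pX => //; p_integral.
by field; rewrite b k0.
Qed.

(** The binomial expansion of (p - k)^-3 in powers of p / k. *)
Lemma reflect_inv3 k : (0 < k < p)%N ->
  val_ge p 3 (k%:R^-1 ^+ 3 + (p - k)%N%:R^-1 ^+ 3
           + 3%:R * P * k%:R^-1 ^+ 4 + 6%:R * P ^+ 2 * k%:R^-1 ^+ 5).
Proof.
move=> kp; have a := val_ge_inv_sub p_prime kp; have b := natr_subp_neq0 kp.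
have k0 : k%:R != 0 :> rat by rewrite pnatr_eq0; lia.
have hu : val_ge p 0 k%:R^-1 by p_integral.
rewrite natrB; last by lia.
rewrite (_ : _ + _ = P ^+ 3 * ((10%:R * k%:R^-1 ^+ 3 - 15%:R * P * k%:R^-1 ^+ 4
   + 6%:R * P ^+ 2 * k%:R^-1 ^+ 5) * (P - k%:R)^-1 ^+ 3)).
  by apply: val_ge_pX => //; p_integral.
by field; rewrite b k0.
Qed.

Lemma val_ge_subX r x y n : val_ge p 0 x -> val_ge p 0 y ->
  val_ge p r (x - y) -> val_ge p r (x ^+ n - y ^+ n).
Proof.
move=> hx hy hxy; rewrite subrXX; apply: val_geMr => //.
apply: (big_ind (val_ge p 0)); first exact: val_ge0.
  by move=> *; p_integral.
by move=> i _; p_integral.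
Qed.

Lemma reflect_invX n k : (0 < k < p)%N ->
  val_ge p 1 ((p - k)%N%:R^-1 ^+ n - (-1) ^+ n * k%:R^-1 ^+ n).
Proof.
move=> kp; rewrite -exprMn; have a := val_ge_inv_sub p_prime kp.
have b := natr_subp_neq0 kp.
have k0 : k%:R != 0 :> rat by rewrite pnatr_eq0; lia.
have hu : val_ge p 0 k%:R^-1 by p_integral.
apply: val_ge_subX; [by p_integral | by rewrite mulN1r; p_integral | ].
rewrite natrB; last by lia.
rewrite (_ : _ - _ = P ^+ 1 * (k%:R^-1 * (P - k%:R)^-1)).
  by apply: val_ge_pX => //; p_integral.
by field; rewrite b k0.
Qed.

Lemma psum_reflect1 :
  val_ge p 4 (2%:R * H 1 + P * H 2 + P ^+ 2 * H 3 + P ^+ 3 * H 4).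
Proof.
rewrite [2%:R * _](_ : _ = H 1 + \sum_(1 <= k < p) (p - k)%N%:R^-1 ^+ 1).
  rewrite !psum_predp !mulr_sumr -!big_split /=.
  by apply: val_ge_sum => // k kp; rewrite !expr1; apply: reflect_inv.
by rewrite -(sum_reflect (fun k => k%:R^-1 ^+ 1)) -psum_predp; ring.
Qed.

Lemma psum_reflect3 :
  val_ge p 3 (2%:R * H 3 + 3%:R * P * H 4 + 6%:R * P ^+ 2 * H 5).
Proof.
rewrite [2%:R * _](_ : _ = H 3 + \sum_(1 <= k < p) (p - k)%N%:R^-1 ^+ 3).
  rewrite !psum_predp !mulr_sumr -!big_split /=.
  by apply: val_ge_sum => // k kp; apply: reflect_inv3.
by rewrite -(sum_reflect (fun k => k%:R^-1 ^+ 3)) -psum_predp; ring.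
Qed.

Lemma psum_odd n : odd n -> val_ge p 1 (H n).
Proof.
move=> on; apply: (@val_ge_cancel _ p_prime 1 2); first by apply: ndvd_small; lia.
rewrite (_ : _ * _ = H n + \sum_(1 <= k < p) (p - k)%N%:R^-1 ^+ n).
  rewrite psum_predp -big_split /=; apply: val_ge_sum => // k kp.
  have := reflect_invX n kp; rewrite -signr_odd on expr1 mulN1r opprK.
  by rewrite addrC.
by rewrite -(sum_reflect (fun k => k%:R^-1 ^+ n)) -psum_predp; ring.
Qed.

Lemma odd_prime_half : p = (2 * p./2).+1.
Proof.
have := odd_double_half p; case: (even_prime p_prime) => [|->]; first by lia.
by rewrite add1n mul2n => ->.
Qed.

Lemma psum_double n :
  (2%:R^-1 ^+ n - 1) * H n =
  \sum_(1 <= i < (p./2).+1)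
     ((p + (2 * i).-1)%N%:R^-1 ^+ n - (2 * i).-1%:R^-1 ^+ n).
Proof.
have := sum_double (fun k => k%:R^-1 ^+ n) p./2; rewrite -odd_prime_half => <-.
rewrite mulrBl mul1r -psum_predp; congr (_ - _).
rewrite psum_predp mulr_sumr; apply: eq_bigr => k _.
by rewrite natrM invfM exprMn.
Qed.

Lemma odd_lt i : (1 <= i < (p./2).+1)%N -> (0 < (2 * i).-1 < p)%N.
Proof. by have := odd_prime_half; lia. Qed.

(** Doubling the residues multiplies the sum by 2^-n modulo p, so the sum
    vanishes unless 2^n = 1 modulo p.  Reflecting k to p - k proves this for odd n
    only. *)
Lemma psum_even n : ~~ (p %| 2 ^ n - 1)%N -> val_ge p 1 (H n).
Proof.
move=> h; apply: (val_ge_cancel p_prime h).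
have -> : (2 ^ n - 1)%N%:R * H n = - 2%:R ^+ n * ((2%:R^-1 ^+ n - 1) * H n).
  rewrite natrB ?expn_gt0 // natrX mulrA mulrBr mulNr -exprMn divff //.
  by rewrite expr1n; ring.
rewrite psum_double mulrC; apply: val_geMr => //; first by p_integral.
apply: val_ge_sum => // i /odd_lt; move: (2 * i).-1 => j jp.
have a := val_ge_inv_add jp; have b : j%:R + P != 0 by rewrite -natrD pnatr_eq0; lia.
have k0 : j%:R != 0 :> rat by rewrite pnatr_eq0; lia.
have hu : val_ge p 0 j%:R^-1 by p_integral.
rewrite natrD [P + _]addrC; apply: val_ge_subX => //.
rewrite (_ : _ - _ = P ^+ 1 * - (j%:R^-1 * (j%:R + P)^-1)).
  by apply: val_ge_pX => //; p_integral.
by field; rewrite b k0.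
Qed.

Lemma psum2_mod : val_ge p 1 (H 2).
Proof. by apply: psum_even; apply: ndvd_small; lia. Qed.

Lemma psum4_mod : val_ge p 1 (H 4).
Proof.
apply: psum_even; rewrite (_ : 2 ^ 4 - 1 = 3 * 5)%N // Euclid_dvdM // negb_or.
by apply/andP; split; apply: ndvd_small; lia.
Qed.

Lemma psum3_mod : val_ge p 2 (H 3).
Proof.
apply: (@val_ge_cancel _ p_prime 2 2); first by apply: ndvd_small; lia.
have [x hx ex] := val_ge_cofactor (val_ge_le p_prime (isT : (2 <= 3)%N) psum_reflect3).
have [y hy ey] := val_ge_cofactor psum4_mod.
have h5 : val_ge p 0 (H 5) by apply: val_ge_psum; lia.
have -> : 2%:R * H 3 = P ^+ 2 * (x - 3%:R * y - 6%:R * H 5).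
  by move: ex; rewrite ey; lra.
by apply: val_ge_pX => //; p_integral.
Qed.

Lemma psum1_psum2 : val_ge p 4 (2%:R * H 1 + P * H 2).
Proof.
have [x hx ex] := val_ge_cofactor psum_reflect1.
have [y hy ey] := val_ge_cofactor psum3_mod.
have [z hz ez] := val_ge_cofactor psum4_mod.
have -> : 2%:R * H 1 + P * H 2 = P ^+ 4 * (x - y - z).
  by move: ex; rewrite ey ez => /(canRL (addrK _)) /(canRL (addrK _)) ->; ring.
by apply: val_ge_pX => //; p_integral.
Qed.

(** Wolstenholme's theorem. *)
Lemma psum1_mod : val_ge p 2 (H 1).
Proof.
apply: (@val_ge_cancel _ p_prime 2 2); first by apply: ndvd_small; lia.
have [x hx ex] := val_ge_cofactor (val_ge_le p_prime (isT : (2 <= 4)%N) psum1_psum2).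
have [y hy ey] := val_ge_cofactor psum2_mod.
have -> : 2%:R * H 1 = P ^+ 2 * (x - y).
  by move: ex; rewrite ey => /(canRL (addrK _)) ->; ring.
by apply: val_ge_pX => //; p_integral.
Qed.

(** H_1 can be folded in two ways into sums over j <= (p - 1) / 2:
    pairing j with p - j, and pairing 2j with p - 2j.  Eliminating the sum of
    j^-3 between the two expansions leaves the sum of j^-2. *)
Lemma psum2_half : val_ge p 4 (7%:R * H 1 + P * psum 2 p./2).
Proof.
have h4 : val_ge p 1 (psum 4 p./2).
  apply: (@val_ge_cancel _ p_prime 1 2); first by apply: ndvd_small; lia.
  have -> : 2%:R * psum 4 p./2 = H 4 - \sum_(1 <= i < (p./2).+1)
       ((p - i)%N%:R^-1 ^+ 4 - i%:R^-1 ^+ 4).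
    have := sum_fold (fun k => k%:R^-1 ^+ 4) p./2.
    rewrite -odd_prime_half -psum_predp => ->.
    by rewrite sumrB big_split /= /psum; ring.
  apply: val_geB => //; first exact: psum4_mod.
  apply: val_ge_sum => // i ip; have := @reflect_invX 4 i.
  by rewrite -signr_odd expr0 mul1r; apply; have := odd_prime_half; lia.
have h1 : val_ge p 4 (H 1 + P * psum 2 p./2 + P ^+ 2 * psum 3 p./2
                   + P ^+ 3 * psum 4 p./2).
  have := sum_fold (fun k => k%:R^-1 ^+ 1) p./2.
  rewrite -odd_prime_half -psum_predp => ->.
  rewrite /psum !mulr_sumr -!big_split /=.
  apply: val_ge_sum => // k kp; rewrite !expr1.
  by apply: reflect_inv; have := odd_prime_half; lia.
have h2 : val_ge p 4 (H 1 + P * (psum 2 p./2 / 4%:R) + P ^+ 2 * (psum 3 p./2 / 8%:R)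
                   + P ^+ 3 * (psum 4 p./2 / 16%:R)).
  have := sum_even_odd_reflect (fun k => k%:R^-1 ^+ 1) p./2.
  rewrite -odd_prime_half -psum_predp => ->.
  rewrite /psum !mulr_suml !mulr_sumr -!big_split /=.
  apply: val_ge_sum => // k kp; rewrite !expr1.
  have kp2 : (0 < 2 * k < p)%N by have := odd_prime_half; lia.
  apply: (eq_ind _ (val_ge p 4) (reflect_inv kp2)).
  move: ((p - _)%N%:R^-1) => r.
  by rewrite natrM; field; rewrite pnatr_eq0; lia.
have [x hx ex] := val_ge_cofactor h1.
have [y hy ey] := val_ge_cofactor h2.
have [z hz ez] := val_ge_cofactor h4.
have -> : 7%:R * H 1 + P * psum 2 p./2 = P ^+ 4 * (8%:R * y - x + z / 2%:R).
  transitivity (8%:R * (P ^+ 4 * y) - P ^+ 4 * x + P ^+ 3 * (P ^+ 1 * z) / 2%:R).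
    by rewrite -ex -ey -ez; field.
  by ring.
by apply: val_ge_pX => //; p_integral.
Qed.

End PowerSums.

(** * Elementary symmetric functions of the reciprocals *)

(** The third elementary symmetric function of 1, 1/2, ..., 1/k, by Newton's
    formula. *)
Definition esym3 (k : nat) : rat :=
  (psum 1 k ^+ 3 - 3%:R * psum 1 k * psum 2 k + 2%:R * psum 3 k) / 6%:R.

(** The fifth elementary symmetric function of 1, 1/2, ..., 1/k.  The
    expressions in terms of power sums make its divisibility by p visible. *)
Definition esym5 (k : nat) : rat :=
  (psum 1 k ^+ 5 - 10%:R * psum 1 k ^+ 3 * psum 2 k
   + 20%:R * psum 1 k ^+ 2 * psum 3 k + 15%:R * psum 1 k * psum 2 k ^+ 2
   - 20%:R * psum 2 k * psum 3 k - 30%:R * psum 1 k * psum 4 k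
   + 24%:R * psum 5 k) / 120%:R.

(** The product of the 1 + x / j over j <= k, truncated after x^5. *)
Definition esym_trunc (x : rat) (k : nat) : rat :=
  1 + x * psum 1 k + x ^+ 2 * ((psum 1 k ^+ 2 - psum 2 k) / 2%:R)
  + x ^+ 3 * esym3 k
  + x ^+ 4 * ((psum 1 k ^+ 4 - 6%:R * psum 1 k ^+ 2 * psum 2 k
        + 3%:R * psum 2 k ^+ 2 + 8%:R * psum 1 k * psum 3 k - 6%:R * psum 4 k) / 24%:R)
  + x ^+ 5 * esym5 k.

Lemma esym_truncS x k :
  esym_trunc x k * (1 + x * k.+1%:R^-1) - esym_trunc x k.+1
  = x ^+ 6 * (k.+1%:R^-1 * esym5 k).
Proof.
rewrite /esym_trunc /esym3 /esym5 !psumS.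
move: (k.+1%:R^-1) (psum 1 k) (psum 2 k) (psum 3 k) (psum 4 k) (psum 5 k).
by move=> u a b c d e; field.
Qed.

Lemma esym_trunc0 x : esym_trunc x 0 = 1.
Proof. by rewrite /esym_trunc /esym3 /esym5 !psum0; field. Qed.

Lemma sbin_diag n : sbin n%:R n = (-1) ^+ n.
Proof.
elim: n => [|n IHn]; first by rewrite sbin0.
have := sbin_shift n (ler0n rat n); rewrite IHn natr1 => e.
have {}e : sbin n.+1%:R n = n.+1%:R * (-1) ^+ n by rewrite e -natr1; ring.
by rewrite sbinS e exprS -natr1; field; natr_neq0.
Qed.

(** * Bernoulli numbers *)

(** The generating function identity compared in degree m + 1, times
    (m + 1)!. *)
Lemma bernoulli_rec m :
  \sum_(j < m.+1) 'C(m.+1, j)%:R * bernoulli j = (m == 0%N)%:R.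
Proof.
have := bernoulli_egf m.+1; rewrite /fps_mul big_ord_recr /= subnn mulr0 addr0 eqSS.
case: eqP => [->|_] e.
  by rewrite big_ord1 bin0 mul1r; move: e; rewrite big_ord1 /= subn0 fact0 !divr1.
apply: (mulfI (invr_neq0 (fact_natr_neq0 m.+1))); rewrite mulr0 -[RHS]e mulr_sumr.
apply: eq_bigr => -[j jm] _ /=; rewrite subSn //=.
rewrite -(@bin_fact m.+1 j); last exact: ltnW.
rewrite subSn // natrM [(j`! * _)%:R]natrM.
have f1 := fact_natr_neq0 j; have f2 := fact_natr_neq0 (m - j).+1.
have f3 : 'C(m.+1, j)%:R != 0 :> rat by rewrite pnatr_eq0 -lt0n bin_gt0 ltnW.
by move: ((m - j).+1`!%:R) f2 => z f2; field; rewrite f1 f2 f3.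
Qed.

Definition powsum (m n : nat) : rat := \sum_(0 <= k < n) k%:R ^+ m.

(** The sum over k < n of (k + 1)^(m+1) - k^(m+1), computed by telescoping
    and by the binomial theorem. *)
Lemma powsum_rec m n :
  \sum_(j < m.+1) 'C(m.+1, j)%:R * powsum j n = n%:R ^+ m.+1.
Proof.
transitivity (\sum_(0 <= k < n) (k.+1%:R ^+ m.+1 - k%:R ^+ m.+1 : rat)); last first.
  by rewrite (telescope_sumr (fun k => k%:R ^+ m.+1 : rat)) // expr0n subr0.
under eq_bigr => j _ do rewrite /powsum mulr_sumr.
rewrite exchange_big /=; apply: eq_bigr => k _.
rewrite -natr1 [k%:R + 1]addrC exprDn [in RHS]big_ord_recr /=.
rewrite subnn expr0 mul1r binn mulr1n addrK.
by apply: eq_bigr => j _; rewrite expr1n mul1r mulr_natl.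
Qed.

Section Binomial.
Variable p : nat.
Hypothesis p_prime : prime p.
Hypothesis p_gt5 : (5 < p)%N.
Local Notation P := (p%:R : rat).
Local Notation H m := (psum m p.-1).

(** Power sums and p times the Bernoulli numbers satisfy the same
    recurrence up to p^(m+1), and the leading coefficient m + 1 is invertible
    modulo p. *)
Lemma powsum_bernoulli m : (m.+1 < p)%N -> val_ge p 2 (powsum m p - P * bernoulli m).
Proof.
elim/ltn_ind: m => m IHm mp; apply: (@val_ge_cancel _ p_prime 2 m.+1).
  by apply: ndvd_small; lia.
have -> : m.+1%:R * (powsum m p - P * bernoulli m) =
  P ^+ m.+1 - P * (m == 0%N)%:R
  - \sum_(j < m) 'C(m.+1, j)%:R * (powsum j p - P * bernoulli j).
  have -> : \sum_(j < m) 'C(m.+1, j)%:R * (powsum j p - P * bernoulli j) =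
    \sum_(j < m) 'C(m.+1, j)%:R * powsum j p
    - P * \sum_(j < m) 'C(m.+1, j)%:R * bernoulli j.
    by rewrite mulr_sumr -sumrB; apply: eq_bigr => j _; ring.
  by rewrite -bernoulli_rec -powsum_rec !big_ord_recr /= binSn; ring.
apply: val_geB => //.
  case: (m) => [|m']; first by rewrite expr1 mulr1 subrr; apply: val_ge0.
  rewrite mulr0 subr0 (_ : m'.+2 = (2 + m')%N) // exprD.
  by apply: val_ge_pX => //; p_integral.
apply: (big_ind (val_ge p 2)); [exact: val_ge0 | by move=> *; apply: val_geD |].
by move=> [j jm] _ /=; apply: val_geMl => //; [p_integral | apply: IHm => //; lia].
Qed.

Lemma val_ge_dvd n : (p %| n)%N -> val_ge p 1 n%:R.
Proof.
case/dvdnP=> k ->; rewrite natrM mulrC -[X in X * _]expr1.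
by apply: val_ge_pX => //; p_integral.
Qed.

Lemma fermat_natr k : val_ge p 1 (k%:R ^+ p - k%:R).
Proof.
have h : (k <= k ^ p)%N.
  case: (k) => [|k0]; first by [].
  rewrite -{1}(expn1 k0.+1); apply: leq_pexp2l; first by [].
  by rewrite prime_gt0.
rewrite -natrX -natrB //; apply: val_ge_dvd.
by rewrite -eqn_mod_dvd //; apply/eqP; apply: fermat_little.
Qed.

(** Fermat's little theorem, with the inverse taken in the rationals. *)
Lemma fermat_neg (k m n : nat) : (0 < k < p)%N -> (m + n)%N = p.-1 ->
  val_ge p 1 (k%:R ^+ m - k%:R^-1 ^+ n).
Proof.
move=> kp mn; have k0 : k%:R != 0 :> rat by rewrite pnatr_eq0; lia.
apply: (@val_ge_cancel _ p_prime 1 (k ^ n.+1)).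
  by rewrite Euclid_dvdX // negb_and ndvd_small.
rewrite natrX mulrBr -exprD (_ : (n.+1 + m)%N = p); last first.
  by have := prime_gt0 p_prime; lia.
by rewrite exprS -mulrA -exprMn divff // expr1n mulr1; apply: fermat_natr.
Qed.

Lemma expD_mod2 (n : nat) x : val_ge p 0 x ->
  val_ge p 2 ((P + x) ^+ n - x ^+ n - n%:R * P * x ^+ n.-1).
Proof.
move=> hx; case: n => [|n]; first by rewrite !expr0 subrr !mul0r subr0; apply: val_ge0.
rewrite [n.+1.-1]/=; elim: n => [|n IHn].
  by rewrite (_ : _ - _ = 0); [apply: val_ge0 | rewrite expr0; ring].
have [y hy e] := val_ge_cofactor IHn.
rewrite exprS.
have -> : (P + x) ^+ n.+1 = P ^+ 2 * y + x ^+ n.+1 + n.+1%:R * P * x ^+ n.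
  by rewrite -e; ring.
rewrite (_ : _ - _ = P ^+ 2 * ((P + x) * y + n.+1%:R * x ^+ n)).
  by apply: val_ge_pX => //; p_integral.
by rewrite !exprS -!natr1; ring.
Qed.

Lemma inv4_mod2 j : (0 < j < p)%N ->
  val_ge p 2 ((p + j)%N%:R^-1 ^+ 4 - j%:R^-1 ^+ 4 + 4%:R * P * j%:R^-1 ^+ 5).
Proof.
move=> jp; have a := val_ge_inv_add jp.
have b : j%:R + P != 0 by rewrite -natrD pnatr_eq0; lia.
have k0 : j%:R != 0 :> rat by rewrite pnatr_eq0; lia.
have hu : val_ge p 0 j%:R^-1 by p_integral.
rewrite natrD [P + _]addrC.
rewrite (_ : _ + _ = P ^+ 2 * ((10%:R * j%:R^-1 ^+ 2 + 20%:R * P * j%:R^-1 ^+ 3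
   + 15%:R * P ^+ 2 * j%:R^-1 ^+ 4 + 4%:R * P ^+ 3 * j%:R^-1 ^+ 5)
   * (j%:R + P)^-1 ^+ 4)).
  by apply: val_ge_pX => //; p_integral.
by field; rewrite b k0.
Qed.

Lemma powsum_double n : (0 < n)%N ->
  (2%:R ^+ n - 1) * powsum n p =
  \sum_(1 <= i < (p./2).+1) ((p + (2 * i).-1)%N%:R ^+ n - (2 * i).-1%:R ^+ n).
Proof.
move=> n0; have := sum_double (fun k => k%:R ^+ n) p./2.
rewrite -(odd_prime_half p_prime p_gt5) => <-.
have -> : powsum n p = \sum_(1 <= k < p) k%:R ^+ n.
  by rewrite /powsum big_ltn ?prime_gt0 // expr0n eqn0Ngt n0 add0r.
rewrite mulrBl mul1r; congr (_ - _).
by rewrite mulr_sumr; apply: eq_bigr => k _; rewrite natrM exprMn.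
Qed.

(** A special case of Kummer's congruence.  Doubling the residues
    gives (2^m - 1) S_m = m p O_(m-1) modulo p^2, where S_m is the sum of k^m over
    0 < k < p and O_(m-1) that of j^(m-1) over odd j.  For m = -4 and m = p - 5 the
    odd sums agree modulo p, and so do the factors 2^m - 1, which are -15/16. *)
Lemma psum4_powsum : val_ge p 2 (5%:R * H 4 - 4%:R * powsum (p - 5) p).
Proof.
pose O : rat := \sum_(1 <= i < (p./2).+1) (2 * i).-1%:R^-1 ^+ 5.
set T := powsum _ _.
have hO : val_ge p 0 O.
  apply: val_ge_sum => // i /(odd_lt p_prime p_gt5) ip; p_integral.
have a : val_ge p 2 ((2%:R^-1 ^+ 4 - 1) * H 4 + 4%:R * P * O).
  rewrite (psum_double p_prime) // /O mulr_sumr -big_split /=.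
  by apply: val_ge_sum => // i /(odd_lt p_prime p_gt5) ip; apply: inv4_mod2.
have b : val_ge p 2 ((2%:R ^+ (p - 5) - 1) * T + 5%:R * P * O).
  rewrite /T powsum_double; last by lia.
  rewrite /O mulr_sumr -big_split /=.
  apply: val_ge_sum => // i /(odd_lt p_prime p_gt5); move: (2 * i).-1 => j jp.
  have hj : val_ge p 0 j%:R by p_integral.
  have [y hy ey] := val_ge_cofactor (expD_mod2 (p - 5) hj).
  have [z hz ez] := val_ge_cofactor (@fermat_neg j (p - 5).-1 5 jp ltac:(lia)).
  have hM : (p - 5)%N%:R = P - 5%:R :> rat by rewrite natrB // ltnW.
  rewrite natrD (_ : _ + _ = P ^+ 2 * (y + j%:R ^+ (p - 5).-1 - 5%:R * z)).
    by apply: val_ge_pX => //; p_integral.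
  have e1 : (P + j%:R) ^+ (p - 5) - j%:R ^+ (p - 5) =
    P ^+ 2 * y + (P - 5%:R) * P * j%:R ^+ (p - 5).-1 by rewrite -ey hM; ring.
  have e2 : j%:R^-1 ^+ 5 = j%:R ^+ (p - 5).-1 - P ^+ 1 * z by rewrite -ez; ring.
  by rewrite e1 e2; ring.
have hT : val_ge p 0 T by apply: val_ge_sum => // k _; p_integral.
have d : val_ge p 1 (2%:R ^+ (p - 5) - 2%:R^-1 ^+ 4).
  by apply: fermat_neg; lia.
have [x hx ex] := val_ge_cofactor a.
have [y hy ey] := val_ge_cofactor b.
have [z hz ez] := val_ge_cofactor d.
have eT : (2%:R^-1 ^+ 4 - 1) * T = P ^+ 2 * y - 5%:R * P * O - P * z * T.
  by rewrite -ey -[P * z]/(P ^+ 1 * z) -ez; ring.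
(* needed to replace 2^(p-5) by 2^-4 in front of T modulo p^2 *)
have hT1 : val_ge p 1 T.
  apply: (@val_ge_cancel _ p_prime 1 15).
    by rewrite (_ : 15 = 3 * 5)%N // Euclid_dvdM // negb_or !ndvd_small //; lia.
  (* 2^-4 - 1 = -15/16 *)
  rewrite (_ : _ * T = P ^+ 1 * (- 16%:R * (P * y - 5%:R * O - z * T))).
    by apply: val_ge_pX => //; p_integral.
  transitivity (- 16%:R * ((2%:R^-1 ^+ 4 - 1) * T)); first by field.
  by rewrite eT; ring.
have [t ht et] := val_ge_cofactor hT1.
apply: (@val_ge_cancel _ p_prime 2 15).
  by rewrite (_ : 15 = 3 * 5)%N // Euclid_dvdM // negb_or !ndvd_small //; lia.
rewrite (_ : _ * _ = P ^+ 2 * (- 16%:R * (5%:R * x - 4%:R * (y - z * t)))).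
  by apply: val_ge_pX => //; p_integral.
transitivity (- 16%:R * (5%:R * ((2%:R^-1 ^+ 4 - 1) * H 4)
                         - 4%:R * ((2%:R^-1 ^+ 4 - 1) * T))); first by field.
have eH : (2%:R^-1 ^+ 4 - 1) * H 4 = P ^+ 2 * x - 4%:R * P * O by rewrite -ex; ring.
by rewrite eT eH et; ring.
Qed.

(** By reflection 2 H_3 = -3 p H_4 modulo p^3, and H_4 is known modulo
    p^2 from [psum4_powsum] and [powsum_bernoulli]. *)
Lemma psum3_bernoulli : val_ge p 3 (5%:R * H 3 + 6%:R * P ^+ 2 * bernoulli (p - 5)).
Proof.
have hb : ((p - 5).+1 < p)%N by lia.
have [x hx ex] := val_ge_cofactor (psum_reflect3 p_prime p_gt5).
have [y hy ey] := val_ge_cofactor (psum_odd p_prime p_gt5 (isT : odd 5)).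
have [z hz ez] := val_ge_cofactor psum4_powsum.
have [w hw ew] := val_ge_cofactor (powsum_bernoulli hb).
apply: (@val_ge_cancel _ p_prime 3 2); first by apply: ndvd_small; lia.
rewrite (_ : _ * _ = P ^+ 3 * (5%:R * x - 30%:R * y - 3%:R * (z + 4%:R * w))).
  by apply: val_ge_pX => //; p_integral.
transitivity (5%:R * (P ^+ 3 * x) - 30%:R * P ^+ 2 * (P ^+ 1 * y)
              - 3%:R * P * (P ^+ 2 * z) - 12%:R * P * (P ^+ 2 * w)); last by ring.
by rewrite -ex -ey -ez -ew; ring.
Qed.

End Binomial.

(** * The two sums of the Wilf-Zeilberger decomposition modulo powers of p *)

Lemma invbin_fact n k : invbin n%:R k = n`!%:R * k`!%:R / (n + k)`!%:R.
Proof.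
have f := fact_natr_neq0; elim: k => [|k IHk].
  by rewrite invbin0 addn0 fact0 mulr1 divff.
have f1 := f n; have f2 := f k; have f3 := f (n + k)%N.
rewrite invbinS IHk addnS !factS_natr natrD -natr1; field; natr_neq0.
Qed.

Lemma wz_invbin n k : wz n k =
  (2%:R * n%:R + 1) / n.+1%:R ^+ 3 * invbin n.+1%:R n * invbin n.+1%:R k ^+ 2.
Proof.
rewrite !invbin_fact /wz !addSn addnn -mul2n !factS_natr.
have f1 := fact_natr_neq0 n; have f2 := fact_natr_neq0 k.
have f3 := fact_natr_neq0 (n + k); have f4 := fact_natr_neq0 (2 * n).
rewrite -!natr1 natrM natrD; field; natr_neq0.
Qed.

(** The horizontal part of the path.  [sum_invbin_sqr] expresses the sum of
    the squares through that of the squares over k with a factor x^2, and its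
    coefficient 1 - 2x cancels the factor 2n + 1 of [wz_invbin];
    [sum_invbin_sqr_div] gains a further factor x. *)
Lemma sum_wz n :
  let x : rat := n.+1%:R in let c := invbin x n in
  x ^+ 3 * \sum_(0 <= k < n) wz n k =
  - c * (- 2%:R * x + (3%:R * x - 1) * c ^+ 2 + x / 2%:R * (1 - c ^+ 2)
         - x ^+ 3 / 2%:R * \sum_(1 <= k < n.+1) invbin x k ^+ 2 / k%:R ^+ 2).
Proof.
move=> x c; have x0 : 0 <= x by apply: ler0n.
have xn0 : x != 0 by rewrite pnatr_eq0.
have e1 := sum_invbin_sqr n x0; have e2 := sum_invbin_sqr_div n x0.
have e0 : \sum_(0 <= k < n) invbin x k ^+ 2 =
    1 + \sum_(1 <= k < n.+1) invbin x k ^+ 2 - c ^+ 2.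
  transitivity (\sum_(0 <= k < n.+1) invbin x k ^+ 2 - c ^+ 2).
    by rewrite big_nat_recr //= addrK.
  by rewrite big_ltn // invbin0 expr1n.
have -> : \sum_(0 <= k < n) wz n k =
    (2%:R * n%:R + 1) / x ^+ 3 * c * \sum_(0 <= k < n) invbin x k ^+ 2.
  by rewrite mulr_sumr; apply: eq_bigr => k _; rewrite wz_invbin.
rewrite e0; have -> : 2%:R * n%:R + 1 = 2%:R * x - 1 by rewrite /x -natr1; ring.
rewrite -/x -/c in e1 e2; move: e1 e2.
set S0 := \sum_(_ <= _ < _) _; set S1 := \sum_(_ <= _ < _) _ / _.
set S2 := \sum_(_ <= _ < _) _ / _.
move=> e1 e2.
transitivity (- c * ((1 - 2%:R * x) * S0 + (1 - 2%:R * x) * (1 - c ^+ 2))).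
  field; natr_neq0.
rewrite e1; have -> : x ^+ 2 * S1 = x / 2%:R * (2%:R * x * S1) by field.
by rewrite (canRL (addrK _) e2); field.
Qed.

Section Assembly.
Variable p : nat.
Hypothesis p_prime : prime p.
Hypothesis p_gt5 : (5 < p)%N.
Local Notation P := (p%:R : rat).
Local Notation H m := (psum m p.-1).

Lemma val_ge_invbin k : (k < p)%N -> val_ge p 0 (invbin P k).
Proof.
elim: k => [|k IHk] kp; first by rewrite invbin0; p_integral.
rewrite invbinS; apply: val_geMl => //; first exact/IHk/ltnW.
by apply: val_geMl => //; [p_integral | apply: val_ge_inv_add; lia].
Qed.

(** By [esym_truncS] the truncation obeys the recurrence of the
    product up to a multiple of x^6. *)
Lemma esym_trunc_prod (s : rat) (f : nat -> rat) : val_ge p 0 s ->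
  f 0%N = 1 -> (forall k, f k.+1 = f k * (1 + s * P * k.+1%:R^-1)) ->
  forall k, (k < p)%N -> val_ge p 6 (f k - esym_trunc (s * P) k).
Proof.
move=> hs f0 fS; elim=> [|k IHk] kp.
  by rewrite f0 esym_trunc0 subrr; apply: val_ge0.
have [y hy e] := val_ge_cofactor (IHk (ltnW kp)).
have hk : val_ge p 0 k.+1%:R^-1 by p_integral.
have h5 : val_ge p 0 (esym5 k).
  have [h1 h2 h3 h4] : [/\ val_ge p 0 (psum 1 k), val_ge p 0 (psum 2 k),
     val_ge p 0 (psum 3 k) & val_ge p 0 (psum 4 k)]
    by split; apply: val_ge_psum => //; lia.
  have h5 : val_ge p 0 (psum 5 k) by apply: val_ge_psum => //; lia.
  rewrite /esym5 (_ : 120%:R^-1 = 2%:R^-1 ^+ 3 * 3%:R^-1 * 5%:R^-1 :> rat).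
    by p_integral.
  by field.
rewrite fS -(subrK (esym_trunc (s * P) k) (f k)) e.
rewrite (_ : _ - _ = P ^+ 6 * (y * (1 + s * P * k.+1%:R^-1)
                               + s ^+ 6 * (k.+1%:R^-1 * esym5 k))).
  by apply: val_ge_pX => //; p_integral.
rewrite mulrDl -addrA esym_truncS exprMn; ring.
Qed.

(** Let f(x) be the product of the 1 + x / j over 0 < j < p.  Then
    f(p) = binom(2p - 1, p - 1) and f(-p) = 1, so f(p) - 1 = f(p) - f(-p) involves
    only odd elementary symmetric functions; the fifth one is divisible
    by p. *)
Lemma invbin_expansion :
  val_ge p 6 (invbin P p.-1 - (1 - 2%:R * P * H 1 - 2%:R / 3%:R * P ^+ 3 * H 3)).
Proof.
have pp : (p.-1 < p)%N by rewrite prednK // prime_gt0.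
have z1 : val_ge p 0 1 by p_integral.
have zm1 : val_ge p 0 (-1) by p_integral.
have [y hy ey] := val_ge_cofactor (@esym_trunc_prod 1 (fun k => (invbin P k)^-1)
  z1 ltac:(by rewrite /= invbin0 invr1)
  ltac:(by move=> k /=; rewrite invbinS invfM; congr (_ * _); field; natr_neq0) _ pp).
have [z hz ez] := val_ge_cofactor (@esym_trunc_prod (-1) (sbin p.-1%:R)
  zm1 ltac:(by rewrite sbin0)
  ltac:(by move=> k; rewrite sbinS; congr (_ * _);
    rewrite -[in RHS](prednK (prime_gt0 p_prime)) -!natr1; field; natr_neq0) _ pp).
have od : odd p.-1 = false by have := odd_prime_half p_prime p_gt5; lia.
rewrite sbin_diag -signr_odd od expr0 in ez.
have [a ha ea] := val_ge_cofactor (psum1_mod p_prime p_gt5).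
have [b hb eb] := val_ge_cofactor (psum2_mod p_prime p_gt5).
have [c hc ec] := val_ge_cofactor (psum3_mod p_prime p_gt5).
have [d hd ed] := val_ge_cofactor (psum4_mod p_prime p_gt5).
have [e he ee] := val_ge_cofactor (psum_odd p_prime p_gt5 (isT : odd 5)).
pose C := (invbin P p.-1)^-1.
have hi : val_ge p 0 (invbin P p.-1) by apply: val_ge_invbin.
have i0 : invbin P p.-1 != 0.
  rewrite invbin_fact mulf_neq0 ?invr_neq0 ?mulf_neq0 ?fact_natr_neq0 //.
have [w hw ew] : exists2 w, val_ge p 0 w &
    C = 1 + 2%:R * P ^+ 3 * a + 2%:R / 3%:R * P ^+ 5 * c + P ^+ 6 * w.
  (* e5 is esym5 p.-1 divided by p, up to the factor 1/120 *)
  pose e5 : rat := P ^+ 9 * a ^+ 5 - 10%:R * P ^+ 6 * a ^+ 3 * b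
    + 20%:R * P ^+ 5 * a ^+ 2 * c + 15%:R * P ^+ 3 * a * b ^+ 2
    - 20%:R * P ^+ 2 * b * c - 30%:R * P ^+ 2 * a * d + 24%:R * e.
  exists (y - z + (P ^+ 3 * a ^+ 3 - 3%:R * a * b) / 3%:R
          + 2%:R * (e5 * (2%:R^-1 ^+ 3 * 3%:R^-1 * 5%:R^-1))).
    by rewrite /e5; p_integral.
  have -> : C = P ^+ 6 * y - P ^+ 6 * z + 1
     + (esym_trunc (1 * P) p.-1 - esym_trunc (-1 * P) p.-1).
    by rewrite -ey -ez /C; ring.
  by rewrite /esym_trunc /esym3 /esym5 ea eb ec ed ee /e5; field.
pose dl := 2%:R * a + 2%:R / 3%:R * P ^+ 2 * c + P ^+ 3 * w.
rewrite (_ : _ - _ = P ^+ 6 * (invbin P p.-1 * dl ^+ 2 - w)).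
  by apply: val_ge_pX => //; rewrite /dl; p_integral.
have eC : C = 1 + P ^+ 3 * dl by rewrite ew /dl; ring.
have e1 : invbin P p.-1 * C = 1 by rewrite divff.
(* inversion of 1 + p^3 dl modulo p^6 *)
have e2 : invbin P p.-1 = 1 - P ^+ 3 * dl + invbin P p.-1 * (P ^+ 3 * dl) ^+ 2.
  move: e1; rewrite eC => e1.
  transitivity (invbin P p.-1 * (1 + P ^+ 3 * dl) * (1 - P ^+ 3 * dl)
                + invbin P p.-1 * (P ^+ 3 * dl) ^+ 2); first by ring.
  by rewrite e1 mul1r.
by rewrite {1}e2 ea ec /dl; ring.
Qed.

Local Notation Q := (\sum_(1 <= k < p) wpbin P k / k%:R ^+ 2).
Local Notation Z := (\sum_(1 <= k < p) invbin P k ^+ 2 / k%:R ^+ 2).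
Local Notation X := (\sum_(1 <= k < p) psum 1 k * k%:R^-1 ^+ 2).
Local Notation Y := (\sum_(1 <= k < p) psum 2 k * k%:R^-1 ^+ 1).
Local Notation W := (\sum_(1 <= k < p) psum 2 k * k%:R^-1 ^+ 2).

Lemma inv_add_expansion k : (0 < k < p)%N ->
  val_ge p 4 ((p + k)%N%:R^-1 - k%:R^-1
           + P * k%:R^-1 ^+ 2 - P ^+ 2 * k%:R^-1 ^+ 3 + P ^+ 3 * k%:R^-1 ^+ 4).
Proof.
move=> kp; have a := val_ge_inv_add kp.
have b : k%:R + P != 0 by rewrite -natrD pnatr_eq0; lia.
have k0 : k%:R != 0 :> rat by rewrite pnatr_eq0; lia.
have hu : val_ge p 0 k%:R^-1 by p_integral.
rewrite natrD [P + _]addrC.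
rewrite (_ : _ + _ = P ^+ 4 * (k%:R^-1 ^+ 4 * (k%:R + P)^-1)).
  by apply: val_ge_pX => //; p_integral.
by field; rewrite b k0.
Qed.

Lemma sum_inv_add : \sum_(1 <= k < p) (p + k)%N%:R^-1
  = psum 1 (2 * p) - psum 1 p - 1 / (2%:R * P).
Proof.
have -> : psum 1 (2 * p) = psum 1 p + \sum_(1 <= k < p.+1) (p + k)%N%:R^-1.
  rewrite /psum (@big_cat_nat _ _ _ p.+1 1 (2 * p).+1) //=; last by lia.
  congr (_ + _); rewrite -{1}(add1n p) big_addn.
  rewrite (_ : ((2 * p).+1 - p = p.+1)%N); last by lia.
  by apply: eq_big_nat => k _; rewrite expr1 addnC.
rewrite big_nat_recr ?prime_gt0 //= addnn -mul2n natrM; ring.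
Qed.

(** In the closed form of [sum_wpbin_sqr] for p the denominators
    divisible by p cancel, and what is left is expanded in powers of p. *)
Lemma sum_wpbin_mod : val_ge p 4 (P * Q - 4%:R * H 1).
Proof.
have P0 := prime_natr_neq0 p_prime.
have eQ : P * Q = - P / 2%:R * H 2 + \sum_(1 <= k < p) (p + k)%N%:R^-1.
  have := sum_wpbin_sqr p.-1; rewrite prednK ?prime_gt0 // => ->.
  rewrite sum_inv_add -[in psum 2 p](prednK (prime_gt0 p_prime)) psumS.
  by rewrite prednK ?prime_gt0 //; field.
have h : val_ge p 4 (\sum_(1 <= k < p) (p + k)%N%:R^-1 - H 1 + P * H 2
                  - P ^+ 2 * H 3 + P ^+ 3 * H 4).
  rewrite !psum_predp // !mulr_sumr -!sumrN -!big_split /=.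
  apply: val_ge_sum => // k kp; rewrite expr1; exact: inv_add_expansion.
have [a ha ea] := val_ge_cofactor h.
have [b hb eb] := val_ge_cofactor (psum1_psum2 p_prime p_gt5).
have [c hc ec] := val_ge_cofactor (psum3_mod p_prime p_gt5).
have [d hd ed] := val_ge_cofactor (psum4_mod p_prime p_gt5).
rewrite (_ : _ - _ = P ^+ 4 * (a + c - d - 3%:R / 2%:R * b)).
  by apply: val_ge_pX => //; p_integral.
transitivity (P ^+ 4 * a + P ^+ 2 * (P ^+ 2 * c) - P ^+ 3 * (P ^+ 1 * d)
              - 3%:R / 2%:R * (P ^+ 4 * b)); last by ring.
by rewrite -ea -eb -ec -ed eQ; field.
Qed.

(** Twice this sum is H_2^2 + H_4. *)
Lemma sum_psum2_sqr_mod : val_ge p 1 W.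
Proof.
apply: (@val_ge_cancel _ p_prime 1 2); first by apply: ndvd_small; lia.
have := stuffle 2 2 p.-1; rewrite big_split /= prednK ?prime_gt0 // => e.
have -> : 2%:R * W = H 2 * H 2 + H 4 by rewrite -e; ring.
apply: val_geD => //; last exact: psum4_mod.
by apply: val_geMl => //; [apply: val_ge_psum; lia | apply: psum2_mod].
Qed.

(** By [invbin_sqr] and [sqbin_expansion], Z and Q differ by p^2 W
    modulo p^3, and p divides W. *)
Lemma sum_invbin_mod : val_ge p 4 (P * Z - 4%:R * H 1).
Proof.
have -> : P * Z - 4%:R * H 1 = P * Q - 4%:R * H 1 + P * (Z - Q) by ring.
apply: val_geD => //; first exact: sum_wpbin_mod.
apply/val_ge_mulp => //.
have -> : Z - Q = P ^+ 2 * W + \sum_(1 <= k < p)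
   (invbin P k ^+ 2 / k%:R ^+ 2 - wpbin P k / k%:R ^+ 2
    - P ^+ 2 * (psum 2 k * k%:R^-1 ^+ 2)).
  by rewrite !sumrB mulr_sumr; ring.
apply: val_geD => //.
  have [w hw ->] := val_ge_cofactor sum_psum2_sqr_mod.
  by rewrite mulrA -exprD; apply: val_ge_pX.
apply: val_ge_sum => // k kp; rewrite invbin_sqr; last by case/andP: kp.
have kp' : (k < p)%N by case/andP: kp.
have [a ha /(canRL (subrK _)) ->] := val_ge_cofactor (sqbin_expansion p_prime kp').
have [b hb /(canRL (subrK _)) ->] := val_ge_cofactor (wpbin_expansion p_prime kp').
have h1 : val_ge p 0 (psum 1 k) by apply: val_ge_psum.
have h2 : val_ge p 0 (psum 2 k) by apply: val_ge_psum.
have hu : val_ge p 0 k%:R^-1 by p_integral.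
have k0 : k%:R != 0 :> rat by rewrite pnatr_eq0; lia.
move: (psum 1 k) (psum 2 k) h1 h2 => g h h1 h2.
set q := P ^+ 3 * b + _.
rewrite (_ : _ - _ = P ^+ 3 * (k%:R^-1 ^+ 2 * (q * P * a
  + h * (P ^+ 2 * b - 2%:R * g + 2%:R * P * g ^+ 2)))).
  by apply: val_ge_pX => //; rewrite /q; p_integral.
by rewrite /q; field.
Qed.

(** Expanding Q involves, besides X, the sum of
    psum 1 k ^+ 2 / k ^+ 2.  That sum occurs in the expansion of the sum of
    sbin p.-1 k / k ^+ 2 as well, and cancels in 4 sbin p.-1 k - wpbin p k; the sums
    of both terms are known. *)
Lemma harmonic_div_sqr : val_ge p 4 (2%:R * P ^+ 2 * X - 3%:R * P * H 2).
Proof.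
have h : val_ge p 3 (\sum_(1 <= k < p) ((4%:R * sbin p.-1%:R k - wpbin P k) / k%:R ^+ 2
   - (3%:R - 2%:R * P * psum 1 k - 2%:R * P ^+ 2 * psum 2 k) * k%:R^-1 ^+ 2)).
  apply: val_ge_sum => // k kp; have kp' : (k < p)%N by case/andP: kp.
  have [a ha /(canRL (subrK _)) ->] :=
    val_ge_cofactor (sbin_expansion p_prime p_gt5 kp').
  have [b hb /(canRL (subrK _)) ->] := val_ge_cofactor (wpbin_expansion p_prime kp').
  have k0 : k%:R != 0 :> rat by rewrite pnatr_eq0; lia.
  have hu : val_ge p 0 k%:R^-1 by p_integral.
  rewrite (_ : _ - _ = P ^+ 3 * (k%:R^-1 ^+ 2 * (4%:R * a - b))).
    by apply: val_ge_pX => //; p_integral.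
  by field.
have [x hx ex] := val_ge_cofactor h.
have [y hy ey] := val_ge_cofactor sum_wpbin_mod.
have [w hw ew] := val_ge_cofactor sum_psum2_sqr_mod.
have [a ha ea] := val_ge_cofactor (psum1_mod p_prime p_gt5).
have [b hb eb] := val_ge_cofactor (psum1_psum2 p_prime p_gt5).
have := sum_sbin_sqr p.-1; rewrite prednK ?prime_gt0 // => es.
have e : P ^+ 3 * x = 4%:R * (- (H 1 ^+ 2 + H 2) / 2%:R) - Q
    - (3%:R * H 2 - 2%:R * P * X - 2%:R * P ^+ 2 * W).
  rewrite -ex -es psum_predp // !mulr_sumr -!sumrB.
  by apply: eq_bigr => k _; rewrite -exprVn; ring.
rewrite (_ : _ - _ = P ^+ 4 * (x + y + 2%:R * P * a ^+ 2 - 2%:R * w + 2%:R * b)).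
  by apply: val_ge_pX => //; p_integral.
transitivity (P * (P ^+ 3 * x) + P ^+ 4 * y + 2%:R * P * (P ^+ 2 * a) ^+ 2
    - 2%:R * P ^+ 3 * (P ^+ 1 * w) + 2%:R * (P ^+ 4 * b)); last by ring.
by rewrite e -ey -ea -ew -eb; field.
Qed.

(** X + Y = H_1 H_2 + H_3, which vanishes modulo p^2. *)
Lemma harmonic2_div : val_ge p 4 (2%:R * P ^+ 2 * Y + 3%:R * P * H 2).
Proof.
have [x hx ex] := val_ge_cofactor harmonic_div_sqr.
have [a ha ea] := val_ge_cofactor (psum1_mod p_prime p_gt5).
have [c hc ec] := val_ge_cofactor (psum3_mod p_prime p_gt5).
have h2 : val_ge p 0 (H 2) by apply: val_ge_psum; lia.
have := stuffle 1 2 p.-1; rewrite big_split /= prednK ?prime_gt0 // => e.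
rewrite (_ : _ + _ = P ^+ 4 * (2%:R * a * H 2 + 2%:R * c - x)).
  by apply: val_ge_pX => //; p_integral.
transitivity (2%:R * P ^+ 2 * ((P ^+ 2 * a) * H 2 + P ^+ 2 * c) - P ^+ 4 * x);
  last by ring.
by rewrite -ex -ea -ec -e; ring.
Qed.

Lemma sum_alternating_sqr :
  \sum_(1 <= k < p) (-1) ^+ k.-1 * k%:R^-1 ^+ 2 = H 2 - psum 2 p./2 / 2%:R.
Proof.
have e := odd_prime_half p_prime p_gt5.
rewrite psum_predp // e !sum_even_odd -e /psum mulr_suml -sumrB.
apply: eq_big_nat => i /andP[i0 _].
rewrite -[(-1) ^+ (2 * i).-1]signr_odd -[(-1) ^+ (2 * i).-1.-1]signr_odd.
have -> : odd (2 * i).-1 = true by lia.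
have -> : odd (2 * i).-1.-1 = false by lia.
have i1 : i%:R != 0 :> rat by rewrite pnatr_eq0 -lt0n.
by rewrite expr0 expr1 natrM; move: ((2 * i).-1%:R^-1) => u; field.
Qed.

Lemma sum_alt_apery_mod :
  val_ge p 4 (P * \sum_(1 <= k < p) alt_apery p.-1 k - (P * H 2 + H 1 + P ^+ 2 * Y)).
Proof.
have -> : P * \sum_(1 <= k < p) alt_apery p.-1 k - (P * H 2 + H 1 + P ^+ 2 * Y) =
  P ^+ 3 * W + \sum_(1 <= k < p) (P * alt_apery p.-1 k
    - (P * k%:R^-1 ^+ 2 + k%:R^-1 ^+ 1 + P ^+ 2 * (psum 2 k * k%:R^-1 ^+ 1)
       + P ^+ 3 * (psum 2 k * k%:R^-1 ^+ 2))).
  by rewrite !psum_predp // sumrB !big_split /= !mulr_sumr; ring.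
apply: val_geD => //.
  have [w hw ->] := val_ge_cofactor sum_psum2_sqr_mod.
  by rewrite mulrA -exprD; apply: val_ge_pX.
apply: val_ge_sum => // k kp; have kp' : (k < p)%N by case/andP: kp.
rewrite alt_apery_sqbin //; last by lia.
have [a ha /(canRL (subrK _)) ->] := val_ge_cofactor (sqbin_expansion p_prime kp').
have k0 : k%:R != 0 :> rat by rewrite pnatr_eq0; lia.
have hu : val_ge p 0 k%:R^-1 by p_integral.
rewrite (_ : _ - _ = P ^+ 4 * (a * (P * k%:R^-1 ^+ 2 + k%:R^-1))).
  by apply: val_ge_pX => //; p_integral.
by field.
Qed.

(** In [apery_sum] the alternating sum is known from [psum2_half] and the
    other one from [sum_alt_apery_mod]; everything becomes a multiple of H_1. *)
Lemma apery_sum_mod :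
  val_ge p 4 (P * \sum_(1 <= k < p) 3%:R / (k%:R ^+ 2 * 'C(2 * k, k)%:R) - H 1).
Proof.
have pK := prednK (prime_gt0 p_prime).
have := apery_sum p.-1; rewrite pK -signr_odd.
have -> : odd p.-1 = false by have := odd_prime_half p_prime p_gt5; lia.
rewrite expr0 mul1r sum_alternating_sqr => ->.
have [x hx ex] := val_ge_cofactor sum_alt_apery_mod.
have [y hy ey] := val_ge_cofactor harmonic2_div.
have [z hz ez] := val_ge_cofactor (psum2_half p_prime p_gt5).
have [b hb eb] := val_ge_cofactor (psum1_psum2 p_prime p_gt5).
rewrite (_ : _ - _ = P ^+ 4 * (- x - y / 2%:R - z + 5%:R / 2%:R * b)).
  by apply: val_ge_pX => //; p_integral.
transitivity (- (P ^+ 4 * x) - P ^+ 4 * y / 2%:R - P ^+ 4 * z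
              + 5%:R / 2%:R * (P ^+ 4 * b)); last by ring.
by rewrite -ex -ey -ez -eb; field.
Qed.

End Assembly.

Theorem theorem5 (p : nat) (p_prime : prime p) (p_gt5 : (5 < p)%N) :
  rat_eqmod p 3
    (\sum_(1 <= k < p)
        (21%:R * k%:R - 8%:R) / (k%:R ^+ 3 * 'C(2 * k, k)%:R ^+ 3)
      + (p%:R - 1) / p%:R ^+ 3)
    (harmonic_number p.-1 / p%:R ^+ 2 * (15%:R * p%:R - 6%:R)
      + 12%:R / 5%:R * p%:R ^+ 2 * bernoulli (p - 5)%N).
Proof.
apply: (val_ge_rat_eqmod p_prime).
have pK := prednK (prime_gt0 p_prime); have P0 := prime_natr_neq0 p_prime.
have -> : harmonic_number p.-1 = psum 1 p.-1.
  by apply: eq_bigr => k _; rewrite expr1.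
have := zeilberger_sum p.-1; rewrite pK => ->.
have [u hu eu] := val_ge_cofactor (apery_sum_mod p_prime p_gt5).
have [a ha ea] := val_ge_cofactor (psum1_mod p_prime p_gt5).
have [g hg eg] := val_ge_cofactor (psum3_mod p_prime p_gt5).
have [w hw ew] := val_ge_cofactor (invbin_expansion p_prime p_gt5).
have [z hz ez] := val_ge_cofactor (sum_invbin_mod p_prime p_gt5).
have [t ht et] := val_ge_cofactor (psum3_bernoulli p_prime p_gt5).
have := sum_wz p.-1; rewrite pK /= => es.
(* clear the denominator p^3 *)
do 3! apply: (proj1 (val_ge_mulp p_prime _ _)).
have eZ : \sum_(1 <= k < p) invbin p%:R k ^+ 2 / k%:R ^+ 2
  = 4%:R * p%:R * a + p%:R ^+ 3 * z.
  apply: (mulfI P0); move: ez => /(canRL (subrK _)) ->; rewrite ea; ring.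
have ec : invbin p%:R p.-1 = 1 - p%:R ^+ 3 *
  (2%:R * a + 2%:R / 3%:R * p%:R ^+ 2 * g - p%:R ^+ 3 * w).
  by move: ew => /(canRL (subrK _)) ->; rewrite ea eg; ring.
have eB : p%:R ^+ 2 * bernoulli (p - 5) = (p%:R ^+ 3 * t - 5%:R * p%:R ^+ 2 * g) / 6%:R.
  by rewrite -et eg; field.
move: eu es => /(canRL (subrK _)).
rewrite eZ ec ea; set s := \sum_(_ <= _ < _) _; set v := \sum_(_ <= _ < _) wz _ _.
set m := (2%:R * a + _ - _); move=> eu es.
(* the inverse of binom(2p-1, p-1) is 1 - p^3 m; all terms of degree below 6 in p
   cancel, and the cofactor collects the others *)
rewrite (_ : _ * _ = p%:R ^+ 6 * (u + 4%:R * g + (3%:R - 6%:R * p%:R) * w + z / 2%:R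
  + m ^+ 2 * (3%:R - 15%:R / 2%:R * p%:R) - m * (4%:R * p%:R * a + p%:R ^+ 3 * z) / 2%:R
  + p%:R ^+ 3 * m ^+ 3 * (5%:R / 2%:R * p%:R - 1) - 2%:R / 5%:R * t)).
  by apply: val_ge_pX => //; rewrite /m; p_integral.
transitivity (p%:R ^+ 2 * (p%:R * s) + p%:R ^+ 3 * v + (p%:R - 1)
  - (p%:R ^+ 3 * a * (15%:R * p%:R - 6%:R)
     + 12%:R / 5%:R * p%:R ^+ 3 * (p%:R ^+ 2 * bernoulli (p - 5)))); first by field.
by rewrite eu es eB /m; field.
Qed.
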